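(* Let $\mathcal{G}=(B,\psi,A)$ be a directed quantum graph such that $\psi$ is a $\delta$-form and $A$ is completely positive, and let $E_{\mathcal{G}}=B\cdot\epsilon_{\mathcal{G}}\cdot B$ be its quantum edge correspondence. Let $(\pi_{E_{\mathcal{G}}},t_{E_{\mathcal{G}}})$ denote the universal covariant representation of $E_{\mathcal{G}}$ on the Cuntz--Pimsner algebra $\mathcal{O}_{E_{\mathcal{G}}}$. Assume $\mathcal{G}$ has no quantum sources. Then the linear map $S\colon B\to\mathcal{O}_{E_{\mathcal{G}}}$ defined by $S(x):=\frac{1}{\delta}t_{E_{\mathcal{G}}}(x\cdot\epsilon_{\mathcal{G}})$ is a local quantum Cuntz--Krieger $\mathcal{G}$-family whose image generates $\mathcal{O}_{E_{\mathcal{G}}}$ (as a C*-algebra). Moreover, given any local quantum Cuntz--Krieger $\mathcal{G}$-family $s\colon B\to D$ in a unital C*-algebra $D$, there exists a $*$-homomorphism $\rho\colon\mathcal{O}_{E_{\mathcal{G}}}\to D$ such that $s=\rho\circ S$.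
   Context: A directed quantum graph $\mathcal{G}=(B,\psi,A)$ consists of a finite-dimensional C*-algebra $B$, a faithful state $\psi$ on $B$ and a linear map $A\colon B\to B$, as follows. Let $m\colon B\otimes B\to B$ be multiplication and $m^*\colon B\to B\otimes B$ its adjoint with respect to the inner products $\langle x,y\rangle_\psi=\psi(x^*y)$ on $B$ and $\langle\cdot,\cdot\rangle_{\psi\otimes\psi}$ on $B\otimes B$. The state $\psi$ is a $\delta$-form ($\delta>0$) if $mm^*=\delta^2\,\mathrm{id}_B$, and $A$ is a quantum adjacency matrix if $m(A\otimes A)m^*=\delta^2A$. A C*-correspondence over $B$ is a right Hilbert $B$-module $X$ with a $*$-homomorphism $\varphi_X\colon B\to\mathcal{L}(X)$ into the adjointable operators; write $x\cdot\xi=\varphi_X(x)\xi$. $B\otimes_\psi B$ is the C*-correspondence over $B$ with underlying space $B\otimes B$, actions $x\cdot(a\otimes b)\cdot y=(xa)\otimes(by)$ and inner product $\langle a\otimes b,c\otimes d\rangle_B=b^*\psi(a^*c)d$. The quantum edge indicator is $\epsilon_{\mathcal{G}}=\frac{1}{\delta^2}(\mathrm{id}\otimes A)m^*(1_B)\in B\otimes_\psi B$, and the quantum edge correspondence is the subcorrespondence $E_{\mathcal{G}}=\mathrm{span}\{x\cdot\epsilon_{\mathcal{G}}\cdot y: x,y\in B\}$. A quantum source in $\mathcal{G}$ is a central summand of $B$ (a nonzero direct summand $zB$, $z$ a central projection) that is contained in $\ker(A)$. A representation of a C*-correspondence $X$ over $B$ on a C*-algebra $D$ is a pair $(\pi,t)$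 with $\pi\colon B\to D$ a $*$-homomorphism and $t\colon X\to D$ linear such that $\pi(x)t(\xi)=t(x\cdot\xi)$ and $t(\xi)^*t(\eta)=\pi(\langle\xi,\eta\rangle_B)$. With $\theta_{\xi,\eta}(\zeta)=\xi\cdot\langle\eta,\zeta\rangle_B$ generating the compact operators $\mathcal{K}(X)$, let $\psi_t\colon\mathcal{K}(X)\to D$ be the $*$-homomorphism with $\psi_t(\theta_{\xi,\eta})=t(\xi)t(\eta)^*$. The representation is covariant if $\pi(x)=\psi_t(\varphi_X(x))$ for all $x\in J_X=\{x\in B:\varphi_X(x)\in\mathcal{K}(X),\ xy=0\ \forall y\in\ker\varphi_X\}$. The Cuntz--Pimsner algebra is $\mathcal{O}_X=C^*(\pi_X(B),t_X(X))$ where $(\pi_X,t_X)$ is the universal covariant representation: for every covariant representation $(\pi,t)$ on $D$ there is a $*$-homomorphism $\rho\colon\mathcal{O}_X\to D$ with $\pi=\rho\circ\pi_X$, $t=\rho\circ t_X$. A local quantum Cuntz--Krieger $\mathcal{G}$-family in a unital C*-algebra $D$ is a linear map $s\colon B\to D$ such that, with $\mu_D\colon D\otimes D\to D$ the multiplication and $s^*(b):=s(b^* )^*$: (LQCK1) $\mu_D(\mu_D\otimes1)(s\otimes s^*\otimes s)(m^*\otimes1)=\frac{1}{\delta^2}sm$ on $B\otimes B$; (LQCK2) $\mu_D(s^*\otimes s)=\frac{1}{\delta^2}\mu_D(s\otimes s^* )m^*Am$ on $B\otimes B$; (LQCK3) $\mu_D(s\otimes s^* )m^*(1_B)=\frac{1}{\delta^2}1_D$.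 *)

(* Defs.v *)
From HB Require Import structures.
From mathcomp Require Import all_boot all_order all_algebra all_field.
From mathcomp Require Import all_real_closed.
From mathcomp Require Import all_classical all_reals all_analysis.

Set Implicit Arguments.
Unset Strict Implicit.
Unset Printing Implicit Defensive.

Import Order.TTheory GRing.Theory Num.Theory numFieldNormedType.Exports.

Local Open Scope ring_scope.

(* Not necessarily unital; the norm of the Banach space takes its (real,
   nonnegative) values in R[i]. *)
HB.mixin Record isCStarAlgebra (R : realType) D of
    CompleteNormedModule R[i] D := {
  cmul : D -> D -> D;
  cstar : D -> D;
  cmulA : associative cmul;
  cmulDl : left_distributive cmul +%R;
  cmulDr : right_distributive cmul +%R;
  cmulZl : forall (a : R[i]) (x y : D), cmul (a *: x) y = a *: cmul x y;
  cmulZr : forall (a : R[i]) (x y : D), cmul x (a *: y) = a *: cmul x y;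
  cstarK : involutive cstar;
  cstarD : {morph cstar : x y / x + y};
  cstarZ : forall (a : R[i]) (x : D), cstar (a *: x) = a^* *: cstar x;
  cstarM : forall x y : D, cstar (cmul x y) = cmul (cstar y) (cstar x);
  cnormM : forall x y : D, `|cmul x y| <= `|x| * `|y|;
  cnorm_star : forall x : D, `|cmul (cstar x) x| = `|x| ^+ 2
}.

#[short(type="cstarAlgType")]
HB.structure Definition CStarAlgebra (R : realType) :=
  { D of isCStarAlgebra R D & CompleteNormedModule R[i] D }.

Declare Scope cstar_scope.
Delimit Scope cstar_scope with cstar.
Local Open Scope cstar_scope.
Notation "x ⋅ y" := (cmul x y) (at level 40, left associativity) : cstar_scope.
Notation "x ^⋆" := (cstar x) (at level 2, format "x ^⋆")
  : cstar_scope.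

(* Every finite-dimensional C*-algebra is unital; the unit is part of the
   data. *)
HB.mixin Record isUnitalCStar (R : realType) B of CStarAlgebra R B := {
  cone : B;
  cmul1x : left_id cone cmul;
  cmulx1 : right_id cone cmul
}.

#[short(type="fdCstarAlgType")]
HB.structure Definition FinDimCStarAlgebra (R : realType) :=
  { B of isUnitalCStar R B & CStarAlgebra R B & Vector R[i] B }.

(* Finite-dimensional tensor products: U ⊗ V is modelled by the matrices of
   coordinates with respect to the bases of U and V given by [vbasis];
   [tens_bilin], [tlift_linear], [tlift_tens] and [tlift_uniq] give the
   universal property of the tensor product. *)
Section TensorProduct.
Variable K : fieldType.
Implicit Types U V : vectType K.

Definition tensor U V : vectType K :=
  'M[K]_(\dim {:U}, \dim {:V}).

Definition bvec U (i : 'I_(\dim {:U})) : U := (vbasis {:U})`_i.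

Definition tens U V (u : U) (v : V) : tensor U V :=
  \matrix_(i, j) (coord (vbasis {:U}) i u * coord (vbasis {:V}) j v).

Definition tcoef U V (T : tensor U V) i j : K :=
  (T : 'M[K]_(\dim {:U}, \dim {:V})) i j.

Definition tlift U V (W : lmodType K) (f : U -> V -> W) (T : tensor U V) : W :=
  \sum_i \sum_j tcoef T i j *: f (bvec i) (bvec j).

Definition bilin U V (W : lmodType K) (f : U -> V -> W) :=
  (forall u, linear (f u)) /\ (forall v, linear (f^~ v)).

Definition tmap U V U' V' (f : U -> U') (g : V -> V') :
    tensor U V -> tensor U' V' :=
  tlift (fun u v => tens (f u) (g v)).

Lemma bvecE U (u : U) : u = \sum_i coord (vbasis {:U}) i u *: bvec i.
Proof. exact: (coord_vbasis (memvf u)). Qed.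

Lemma coord_bvec U (i j : 'I_(\dim {:U})) :
  coord (vbasis {:U}) i (bvec j) = (i == j)%:R.
Proof. by rewrite [LHS]coord_free ?(basis_free (vbasisP _)) // eq_sym. Qed.

Lemma linear_fun_sum U (W : lmodType K) (f : U -> W) (fL : linear f) n
    (a : 'I_n -> K) (x : 'I_n -> U) :
  f (\sum_i a i *: x i) = \sum_i a i *: f (x i).
Proof.
pose fLin : {linear U -> W} :=
  HB.pack f (GRing.isLinear.Build K U W *:%R f fL).
rewrite -[f]/(fLin : U -> W) linear_sum.
by apply: eq_bigr => i _; rewrite linearZ.
Qed.

Lemma tlift_linear U V (W : lmodType K) (f : U -> V -> W) : linear (tlift f).
Proof.
move=> a S T; rewrite /tlift scaler_sumr -big_split; apply: eq_bigr => i _ /=.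
rewrite scaler_sumr -big_split; apply: eq_bigr => j _ /=.
by rewrite /tcoef !mxE scalerDl scalerA.
Qed.

HB.instance Definition _ U V (W : lmodType K) (f : U -> V -> W) :=
  GRing.isLinear.Build K (tensor U V) W *:%R (tlift f) (tlift_linear f).

Lemma tlift_tens U V (W : lmodType K) (f : U -> V -> W) u v :
  bilin f -> tlift f (tens u v) = f u v.
Proof.
move=> [fr fl]; rewrite [in RHS](bvecE u) [in RHS](bvecE v).
rewrite (linear_fun_sum (fl _)); apply: eq_bigr => i _.
rewrite (linear_fun_sum (fr _)) scaler_sumr; apply: eq_bigr => j _.
by rewrite scalerA /tcoef mxE.
Qed.

Lemma tens_bvec U V (T : tensor U V) :
  T = \sum_i \sum_j tcoef T i j *: tens (bvec i) (bvec j).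
Proof.
rewrite {1}[T]matrix_sum_delta; apply: eq_bigr => i _; apply: eq_bigr => j _.
congr (_ *: _); apply/matrixP => k l.
by rewrite !mxE !coord_bvec mulr_natl mulrb; case: eqP => //; case: eqP.
Qed.

Lemma tlift_lin U V (W : lmodType K) k (f g : U -> V -> W) T :
  tlift (fun u v => k *: f u v + g u v) T = k *: tlift f T + tlift g T.
Proof.
rewrite /tlift scaler_sumr -big_split; apply: eq_bigr => i _ /=.
rewrite scaler_sumr -big_split; apply: eq_bigr => j _ /=.
by rewrite scalerDr !scalerA mulrC.
Qed.

Lemma tens_bilin U V : bilin (@tens U V).
Proof.
by split=> [u k v v'|v k u u']; apply/matrixP => i j;
  rewrite !mxE linearP ?mulrDr ?mulrDl mulrA // mulrCA mulrA.
Qed.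

Lemma tlift_uniq U V (W : lmodType K) (g : {linear tensor U V -> W}) T :
  g T = tlift (fun u v => g (tens u v)) T.
Proof.
rewrite [in LHS](tens_bvec T) linear_sum; apply: eq_bigr => i _.
by rewrite linear_sum; apply: eq_bigr => j _; rewrite linearZ.
Qed.

End TensorProduct.

Section CStar.
Variable R : realType.

(* The extension to U ⊗ V of a map F which is conjugate linear in its first
   two arguments and linear in the last two. *)
Definition tsesq (U V : vectType R[i]) (W : lmodType R[i])
    (F : U -> V -> U -> V -> W) (S T : tensor U V) : W :=
  \sum_i \sum_j \sum_k \sum_l
    ((tcoef S i j)^* * tcoef T k l) *: F (bvec i) (bvec j) (bvec k) (bvec l).

Lemma tsesq_tens (U V : vectType R[i]) (W : lmodType R[i])
    (F : U -> V -> U -> V -> W) a b c d :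
    (forall k u u' b c d,
       F (k *: u + u') b c d = k^* *: F u b c d + F u' b c d) ->
    (forall k v v' a c d,
       F a (k *: v + v') c d = k^* *: F a v c d + F a v' c d) ->
    (forall a b, bilin (F a b)) ->
  tsesq F (tens a b) (tens c d) = F a b c d.
Proof.
move=> F1 F2 F34.
have conj_sum (T : vectType R[i]) (f : T -> W) :
    (forall k u u', f (k *: u + u') = k^* *: f u + f u') ->
    forall n (k : 'I_n -> R[i]) (x : 'I_n -> T),
    f (\sum_i k i *: x i) = \sum_i (k i)^* *: f (x i).
  move=> fC; have f0 : f 0 = 0.
    by have := fC (-1) 0 0; rewrite scaler0 addr0 rmorphN1 scaleN1r addNr.
  elim=> [|n IHn] k x; first by rewrite !big_ord0.
  by rewrite !big_ord_recl fC IHn.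
rewrite [in RHS](bvecE a) [in RHS](bvecE b) (conj_sum _ (fun a => F a _ c d)) //.
apply: eq_bigr => i _; rewrite (conj_sum _ (fun b => F _ b c d)) // scaler_sumr.
apply: eq_bigr => j _; rewrite -(tlift_tens c d (F34 _ _)) /tlift !scaler_sumr.
apply: eq_bigr => k _; rewrite !scaler_sumr; apply: eq_bigr => l _.
by rewrite !scalerA {1}/tcoef mxE rmorphM.
Qed.

Definition starhom (A D : cstarAlgType R) (f : A -> D) :=
  [/\ linear f, {morph f : x y / x ⋅ y} & {morph f : x / x^⋆}].

Definition cstar_unit (D : cstarAlgType R) (e : D) :=
  left_id e (@cmul R D) /\ right_id e (@cmul R D).

Definition cstar_subalg (D : cstarAlgType R) (P : set D) :=
  [/\ closed P, P 0,
     forall (a : R[i]) x y, P x -> P y -> P (a *: x + y),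
     forall x y, P x -> P y -> P (x ⋅ y) &
     forall x, P x -> P x^⋆].

Definition cstar_generates (D : cstarAlgType R) (S : set D) :=
  forall P : set D, cstar_subalg P -> (S `<=` P)%classic -> P = setT.

Section FiniteDimensional.
Variable B : fdCstarAlgType R.

Definition faithful_state (psi : {linear B -> R[i]^o}) :=
  [/\ psi cone = 1, forall x, 0 <= psi (x^⋆ ⋅ x) &
     forall x, psi (x^⋆ ⋅ x) = 0 -> x = 0].

Definition mxpositive n (P : 'M[B]_n) :=
  exists Y : 'M[B]_n, P = \matrix_(i, j) \sum_k (Y k i)^⋆ ⋅ Y k j.

Definition completely_positive (A : {linear B -> B}) :=
  forall n (P : 'M[B]_n), mxpositive P -> mxpositive (map_mx A P).

Definition mult : tensor B B -> B := tlift (@cmul R B).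

Section Graph.
Variables (psi : {linear B -> R[i]^o}) (A : {linear B -> B}) (delta : R).

Definition ip (x y : B) : R[i] := psi (x^⋆ ⋅ y).

Definition ip2 (S T : tensor B B) : R[i] :=
  tsesq (W := R[i]^o) (fun a b c d : B => ip a c * ip b d) S T.

(* The adjoint m^* of the multiplication: see [mult_adjE]. *)
Definition mult_adj (x : B) : tensor B B :=
  xget 0 [set S : tensor B B | forall T, ip2 S T = ip x (mult T)]%classic.

Lemma ipDl k x y z : ip (k *: x + y) z = k^* * ip x z + ip y z.
Proof. by rewrite /ip cstarD cstarZ cmulDl cmulZl linearP. Qed.

Lemma ipDr k x y z : ip x (k *: y + z) = k * ip x y + ip x z.
Proof. by rewrite /ip cmulDr cmulZr linearP. Qed.

Lemma ip_suml n (k : 'I_n -> R[i]) (x : 'I_n -> B) z :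
  ip (\sum_i k i *: x i) z = \sum_i (k i)^* * ip (x i) z.
Proof.
have ip0 : ip 0 z = 0.
  by have := ipDl (-1) 0 0 z; rewrite scaler0 addr0 rmorphN1 mulN1r addNr.
by elim: n k x => [|n IHn] k x; rewrite ?big_ord0 // !big_ord_recl ipDl IHn.
Qed.

Lemma ip_sumr n (k : 'I_n -> R[i]) (x : 'I_n -> B) z :
  ip z (\sum_i k i *: x i) = \sum_i k i * ip z (x i).
Proof.
have ip0 : ip z 0 = 0.
  by have := ipDr (-1) z 0 0; rewrite scaler0 addr0 mulN1r addNr.
by elim: n k x => [|n IHn] k x; rewrite ?big_ord0 // !big_ord_recl ipDr IHn.
Qed.

Definition gram : 'M[R[i]]_(\dim {:B}) :=
  \matrix_(i, j) ip (bvec i) (bvec j).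

Lemma gram_unit : faithful_state psi -> gram \in unitmx.
Proof.
move=> [_ _ psi_faithful]; rewrite -row_free_unit -kermx_eq0.
apply/rowV0P => c /sub_kermxP cG0.
pose v : B := \sum_i (c 0 i)^* *: bvec i.
have v0 : v = 0.
  apply: psi_faithful; rewrite -/(ip v v) {1}/v ip_suml.
  under eq_bigr do rewrite /v ip_sumr mulr_sumr conjCK.
  rewrite exchange_big big1 // => j _ /=.
  have /matrixP/(_ 0 j) := cG0; rewrite !mxE => cGj.
  under eq_bigr do rewrite mulrCA.
  rewrite -mulr_sumr -[RHS](mulr0 ((c 0 j)^*)); congr (_ * _).
  by rewrite -[RHS]cGj; apply: eq_bigr => i _; rewrite mxE.
apply/rowP => i; rewrite mxE; apply/eqP; rewrite -conjC_eq0; apply/eqP.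
have := congr1 (coord (vbasis {:B}) i) v0; rewrite linear0 linear_sum.
rewrite (bigD1 i) //= big1 ?addr0 => [|j ji].
  by rewrite linearZ /= coord_bvec eqxx mulr1.
by rewrite linearZ /= coord_bvec eq_sym (negPf ji) mulr0.
Qed.

Lemma mult_adjE : faithful_state psi ->
  forall x T, ip2 (mult_adj x) T = ip x (mult T).
Proof.
move=> /gram_unit G_unit x.
apply: (@xgetPex _ 0 [set S | forall T, ip2 S T = ip x (mult T)]%classic).
pose L : 'M[R[i]]_(\dim {:B}) := \matrix_(k, l) ip x (bvec k ⋅ bvec l).
pose S := map_mx Num.conj (invmx gram^T *m L *m invmx gram).
have SE : gram^T *m map_mx Num.conj S *m gram = L.
  have -> : map_mx Num.conj S = invmx gram^T *m L *m invmx gram.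
    by apply/matrixP => i j; rewrite mxE mxE conjCK.
  by rewrite !mulmxA mulmxV ?unitmx_tr // mul1mx mulmxKV.
pose ip_lin : {linear B -> R[i]^o} :=
  HB.pack (ip x) (GRing.isLinear.Build _ B R[i]^o *:%R (ip x)
    (fun k y z => ipDr k x y z)).
have ipE T : ip x (mult T) = \sum_k \sum_l tcoef T k l * L k l.
  rewrite -[ip x]/(ip_lin : B -> R[i]^o) linear_sum; apply: eq_bigr => k _.
  by rewrite linear_sum; apply: eq_bigr => l _; rewrite linearZ /= mxE.
exists S => T; rewrite ipE /ip2 /tsesq.
under eq_bigr do rewrite exchange_big /=.
rewrite exchange_big /=; apply: eq_bigr => k _.
under eq_bigr do rewrite exchange_big /=.
rewrite exchange_big /=; apply: eq_bigr => l _.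
rewrite exchange_big /= -SE mxE mulr_sumr; apply: eq_bigr => j _.
rewrite mxE mulr_suml mulr_sumr; apply: eq_bigr => i _.
have -> : gram^T k i = ip (bvec i) (bvec k) by rewrite !mxE.
have -> : gram j l = ip (bvec j) (bvec l) by rewrite mxE.
have -> : map_mx Num.conj S i j = (tcoef (S : tensor B B) i j)^* by rewrite mxE.
set s := tcoef _ i j; set t := tcoef _ k l; set g := ip _ _; set h := ip _ _.
by rewrite /GRing.scale /= [s^* * t]mulrC -!mulrA [s^* * _]mulrCA.
Qed.

Definition delta_form :=
  forall x, mult (mult_adj x) = delta%:C%C ^+ 2 *: x.

Definition quantum_adjacency :=
  forall x, mult (tmap A A (mult_adj x)) = delta%:C%C ^+ 2 *: A x.

Definition quantum_graph :=
  [/\ faithful_state psi, 0 < delta, delta_form & quantum_adjacency].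

Definition quantum_source (z : B) :=
  [/\ z != 0, z ⋅ z = z, z^⋆ = z, forall x, z ⋅ x = x ⋅ z &
     forall x, A (z ⋅ x) = 0].

End Graph.

(* The operations of a C*-correspondence over B on a finite-dimensional space,
   without the axioms, which do not enter the definitions below. *)
Record correspondence := Correspondence {
  corr_space :> vectType R[i];
  lact : B -> 'End(corr_space);
  ract : corr_space -> B -> corr_space;
  corr_ip : corr_space -> corr_space -> B
}.

Section CuntzPimsner.
Variable X : correspondence.

Definition theta (xi eta : X) : 'End(X) :=
  linfun (fun zeta => ract xi (corr_ip eta zeta)).

(* No closure is needed, as X is finite-dimensional. *)
Definition compact_op (k : 'End(X)) :=
  exists n (xi eta : 'I_n -> X), k = \sum_i theta (xi i) (eta i).

Definition adjoint_op (k l : 'End(X)) :=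
  forall xi eta, corr_ip (k xi) eta = corr_ip xi (l eta).

Definition katsura_ideal (x : B) :=
  compact_op (lact X x) /\ (forall y, lact X y = 0 -> x ⋅ y = 0).

Definition representation (D : cstarAlgType R) (pi : B -> D) (t : X -> D) :=
  [/\ starhom pi, linear t,
     forall x xi, pi x ⋅ t xi = t (lact X x xi) &
     forall xi eta, (t xi)^⋆ ⋅ t eta = pi (corr_ip xi eta)].

(* psi_t : K(X) -> D, represented by a function whose values outside K(X) are
   irrelevant. *)
Definition compact_rep (D : cstarAlgType R) (t : X -> D) (p : 'End(X) -> D) :=
  [/\ forall (a : R[i]) k l, compact_op k -> compact_op l ->
        p (a *: k + l) = a *: p k + p l,
     forall k l, compact_op k -> compact_op l -> p (k \o l)%VF = p k ⋅ p l,
     forall k l, compact_op k -> compact_op l -> adjoint_op k l ->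
        p l = (p k)^⋆ &
     forall xi eta, p (theta xi eta) = t xi ⋅ (t eta)^⋆].

Definition covariant (D : cstarAlgType R) (pi : B -> D) (t : X -> D) :=
  representation pi t /\
  exists2 p : 'End(X) -> D, compact_rep t p &
    forall x, katsura_ideal x -> pi x = p (lact X x).

(* D is the Cuntz-Pimsner algebra of X and (pi, t) the universal covariant
   representation. *)
Definition cuntz_pimsner (D : cstarAlgType R) (pi : B -> D) (t : X -> D) :=
  [/\ covariant pi t,
     cstar_generates (range pi `|` range t)%classic &
     forall (D' : cstarAlgType R) (pi' : B -> D') (t' : X -> D'),
       covariant pi' t' ->
       exists2 rho : D -> D', starhom rho &
         (forall x, pi' x = rho (pi x)) /\ (forall xi, t' xi = rho (t xi))].

End CuntzPimsner.

Section EdgeCorrespondence.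
Variables (psi : {linear B -> R[i]^o}) (A : {linear B -> B}) (delta : R).

Definition blact (x : B) : tensor B B -> tensor B B :=
  tmap (fun a : B => x ⋅ a) (fun b : B => b).

Definition bract (T : tensor B B) (y : B) : tensor B B :=
  tmap (fun a : B => a) (fun b : B => b ⋅ y) T.

Definition bip (S T : tensor B B) : B :=
  tsesq (fun a b c d : B => psi (a^⋆ ⋅ c) *: (b^⋆ ⋅ d)) S T.

Definition edge_indicator : tensor B B :=
  (delta%:C%C ^+ 2)^-1 *: tmap id A (mult_adj psi cone).

(* The image of x ⊗ y |-> x ⋅ epsilon ⋅ y: see [edge_spaceP]. *)
Definition edge_space : {vspace tensor B B} :=
  limg (linfun (tlift (fun x y : B => bract (blact x edge_indicator) y))).

Lemma edge_spaceP (xi : tensor B B) :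
  reflect (exists n (x y : 'I_n -> B),
             xi = \sum_i bract (blact (x i) edge_indicator) (y i))
          (xi \in edge_space).
Proof.
pose f (x y : B) := bract (blact x edge_indicator) y.
have f_bilin : bilin f.
  split=> [x k y y'|y k x x']; rewrite /f /bract /blact /tmap.
    rewrite -tlift_lin; congr tlift; apply/funext => a; apply/funext => b.
    by rewrite cmulDr cmulZr (tens_bilin _ _).1.
  rewrite -linearP -tlift_lin; do 2!congr tlift.
  apply/funext => a; apply/funext => b.
  by rewrite cmulDl cmulZl (tens_bilin _ _).2.
apply: (iffP memv_imgP) => [[T _ ->]|[n [x [y ->]]]].
  rewrite lfunE /= /tlift pair_bigA /=.
  pose I : finType := ('I_(\dim {:B}) * 'I_(\dim {:B}))%type.
  pose p (k : 'I_#|I|) : I := enum_val k.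
  exists #|I|, (fun k => tcoef T (p k).1 (p k).2 *: bvec (p k).1),
    (fun k => bvec (p k).2).
  rewrite (reindex p) /=; last by apply: onW_bij; exact: enum_val_bij.
  apply: eq_bigr => k _; rewrite -/(f _ _) -/(f _ _).
  have := f_bilin.2 (bvec (p k).2) (tcoef T (p k).1 (p k).2) (bvec (p k).1) 0.
  have -> : f 0 (bvec (p k).2) = 0.
    have := f_bilin.2 (bvec (p k).2) (-1) 0 0.
    by rewrite scaler0 addr0 scaleN1r addNr.
  by rewrite !addr0.
exists (\sum_i tens (x i) (y i)); first exact: memvf.
rewrite lfunE linear_sum; apply: eq_bigr => i _.
by rewrite /= tlift_tens.
Qed.

(* [vsproj] only adds membership in edge_space, which is invariant under both
   actions. *)
Definition edge_corr : correspondence :=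
  @Correspondence (subvs_of edge_space)
    (fun x => linfun (fun xi : subvs_of edge_space =>
       vsproj edge_space (blact x (vsval xi))))
    (fun xi y => vsproj edge_space (bract (vsval xi) y))
    (fun xi eta => bip (vsval xi) (vsval eta)).

Definition edge_vector : edge_corr := vsproj edge_space edge_indicator.

Definition edge_map (D : cstarAlgType R) (t : edge_corr -> D) (x : B) : D :=
  (delta%:C%C)^-1 *: t (lact edge_corr x edge_vector).

End EdgeCorrespondence.

Section LocalFamily.
Variables (psi : {linear B -> R[i]^o}) (A : {linear B -> B}) (delta : R).
Variables (D : cstarAlgType R) (e : D) (s : B -> D).

Definition sadj (b : B) : D := (s b^⋆)^⋆.

(* mu_D (s ⊗ s^* ) and mu_D (s^* ⊗ s) : B ⊗ B -> D *)
Definition mu_s_sadj : tensor B B -> D := tlift (fun a b : B => s a ⋅ sadj b).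
Definition mu_sadj_s : tensor B B -> D := tlift (fun a b : B => sadj a ⋅ s b).

(* mu_D (mu_D ⊗ 1) (s ⊗ s^* ⊗ s) : (B ⊗ B) ⊗ B -> D *)
Definition mu_s_sadj_s : tensor (tensor B B) B -> D :=
  tlift (fun (T : tensor B B) (b : B) => mu_s_sadj T ⋅ s b).

Definition local_QCK_family :=
  [/\ linear s,
     forall T, mu_s_sadj_s (tmap (mult_adj psi) (fun b : B => b) T)
               = (delta%:C%C ^+ 2)^-1 *: s (mult T),
     forall T, mu_sadj_s T
               = (delta%:C%C ^+ 2)^-1 *: mu_s_sadj (mult_adj psi (A (mult T))) &
     mu_s_sadj (mult_adj psi cone) = (delta%:C%C ^+ 2)^-1 *: e].

End LocalFamily.

End FiniteDimensional.
End CStar.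

(* Main.v *)
(* Write m^*(1) = \sum_i p_i ⊗ q_i. The identity \sum_i psi (c p_i) q_i = c
   replaces all use of the modular group of psi; from it one gets
     <x·ε·y, x'·ε·y'> = δ^-2 y^* A(x^* x') y'   and
     \sum_i p_i·ε·<q_i^*·ε, ξ> = ξ.
   So every left multiplication is compact, with x acting as
   \sum_i θ_{x p_i·ε, q_i^*·ε}. If there is no quantum source the left action is
   faithful: a nonzero kernel would be an ideal whose unit is a central projection
   in the kernel of A. Hence covariance reads
     pi x = δ^2 \sum_i S (x p_i) S (q_i^* )^* = δ^2 mu (S ⊗ S^* ) m^*(x),
   which turns the representation axioms into LQCK1-3. Conversely, a family s
   yields pi x := δ^2 mu (s ⊗ s^* ) m^*(x) and t (x·ε·y) := δ s(x) pi(y); the latter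
   is well defined since t(ξ)^* t(η) = pi <ξ, η> forces t to vanish at zero sums. *)
From HB Require Import structures.
Require Import Defs.
From mathcomp Require Import all_boot all_order all_algebra all_field.
From mathcomp Require Import all_real_closed.
From mathcomp Require Import all_classical all_reals all_analysis.

Set Implicit Arguments.
Unset Strict Implicit.
Unset Printing Implicit Defensive.

Import Order.TTheory GRing.Theory Num.Theory numFieldNormedType.Exports.

Local Open Scope ring_scope.
Local Open Scope cstar_scope.

(** * Arithmetic in C*-algebras, polarization and bundled linear maps *)

Section CStarAlgebra.
Context {R : realType} {D : cstarAlgType R}.
Implicit Types x y z : D.

Lemma cmul_linearl y : linear (fun x => x ⋅ y).
Proof. by move=> a x x'; rewrite cmulDl cmulZl. Qed.

Lemma cmul_linearr x : linear (cmul x).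
Proof. by move=> a y y'; rewrite cmulDr cmulZr. Qed.

Lemma cmul0x y : 0 ⋅ y = 0.
Proof. by rewrite -{1}(scale0r (0 : D)) cmulZl scale0r. Qed.

Lemma cmulx0 x : x ⋅ 0 = 0.
Proof. by rewrite -{1}(scale0r (0 : D)) cmulZr scale0r. Qed.

Lemma cmul_suml I (r : seq I) (x : I -> D) y :
  (\sum_(i <- r) x i) ⋅ y = \sum_(i <- r) x i ⋅ y.
Proof.
exact: (big_morph (fun x => x ⋅ y) (fun x x' => cmulDl x x' y) (cmul0x y)).
Qed.

Lemma cmul_sumr I (r : seq I) x (y : I -> D) :
  x ⋅ (\sum_(i <- r) y i) = \sum_(i <- r) x ⋅ y i.
Proof. exact: (big_morph (cmul x) (fun y y' => cmulDr x y y') (cmulx0 x)). Qed.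

Lemma cstar0 : (0 : D)^⋆ = 0.
Proof. by rewrite -{1}(scale0r (0 : D)) cstarZ conjC0 scale0r. Qed.

Lemma cstarN x : (- x)^⋆ = - x^⋆.
Proof. by rewrite -scaleN1r cstarZ rmorphN1 scaleN1r. Qed.

Lemma cstarB x y : (x - y)^⋆ = x^⋆ - y^⋆.
Proof. by rewrite cstarD cstarN. Qed.

Lemma cmulBl x y z : (x - y) ⋅ z = x ⋅ z - y ⋅ z.
Proof. by rewrite cmulDl -scaleN1r cmulZl scaleN1r. Qed.

Lemma cmulBr x y z : x ⋅ (y - z) = x ⋅ y - x ⋅ z.
Proof. by rewrite cmulDr -scaleN1r cmulZr scaleN1r. Qed.

Lemma cstar_sum I (r : seq I) (x : I -> D) :
  (\sum_(i <- r) x i)^⋆ = \sum_(i <- r) (x i)^⋆.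
Proof. exact: (big_morph (@cstar R D) (@cstarD R D) cstar0). Qed.

Lemma cstar1 (B : fdCstarAlgType R) : (cone : B)^⋆ = cone.
Proof. by rewrite -[LHS]cmulx1 -{2}(cstarK cone) -cstarM cmulx1 cstarK. Qed.

Lemma cstar_mul_eq0 x : x^⋆ ⋅ x = 0 -> x = 0.
Proof.
move=> xx0; have := cnorm_star x; rewrite xx0 normr0 => /esym/eqP.
by rewrite expf_eq0 /= normr_eq0 => /eqP.
Qed.

End CStarAlgebra.

Lemma closed_ker (R : numFieldType) (V W : normedModType R)
    (f : {linear V -> W}) (C : R) :
  0 <= C -> (forall x, `|f x| <= C * `|x|) -> closed [set x | f x = 0]%classic.
Proof.
move=> C_ge0 f_le; have f_cont : continuous f.
  apply/linear_bounded_continuous/linear_boundedP; near=> r => x.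
  apply: le_trans (f_le x) _; apply: ler_wpM2r => //.
  by near: r; apply: nbhs_pinfty_ge; exact: ger0_real.
apply: (preimage_closed (D := [set 0]%classic)) => [x _|]; first exact: f_cont.
exact/accessible_closed_set1/hausdorff_accessible/norm_hausdorff.
Unshelve. all: by end_near.
Qed.

(** Bundling allows [linear_sum] and [linearZ] to be applied to a map known only to satisfy
    [linear]; the recurring pattern is to rewrite with [gE], use linearity, and rewrite back. *)
Lemma linear_bundle (K : fieldType) (U V : lmodType K) (f : U -> V) :
  linear f -> exists g : {linear U -> V}, f = g.
Proof.
move=> fL; pose g : {linear U -> V} :=
  HB.pack f (GRing.isLinear.Build K U V *:%R f fL).
by exists g.
Qed.

(* Polarization: the hypothesis is used at a·1 + x for a = 1 and a = i. *)
Lemma hermitian_of_positive (R : realType) (B : fdCstarAlgType R)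
    (W : lmodType R[i]) (f : {linear B -> W}) (J : W -> W) :
    {morph J : x y / x + y} -> (forall a x, J (a *: x) = a^* *: J x) ->
    (forall x, J (f (x^⋆ ⋅ x)) = f (x^⋆ ⋅ x)) ->
  forall x, f x^⋆ = J (f x).
Proof.
move=> JD JZ Jpos x.
have JZpos (a : R[i]) : a *: J (f x) + a^* *: J (f x^⋆) =
    a *: f x^⋆ + a^* *: f x.
  have := Jpos (a *: cone + x).
  rewrite cstarD cstarZ cstar1 !cmulDl !cmulDr !cmulZl !cmulZr !cmul1x !cmulx1.
  have := Jpos cone; rewrite cstar1 cmul1x => J1.
  rewrite !linearD !linearZ /= !JD !JZ /= !conjCK Jpos J1.
  (* The terms in 1 and in x^⋆ x are fixed by [J] and cancel; the two cross terms remain. *)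
  rewrite addrACA [RHS]addrACA !scalerA [a * _]mulrC.
  rewrite -!addrA => /addrI; rewrite !addrA => /addIr.
  by rewrite addrC => ->; rewrite addrC.
have J1 : J (f x) + J (f x^⋆) = f x^⋆ + f x.
  by have := JZpos 1; rewrite conjC1 !scale1r.
have Ji : J (f x) - J (f x^⋆) = f x^⋆ - f x.
  have := JZpos 'i; rewrite conjCi !scaleNr -!scalerBr => /scalerI; apply.
  exact: neq0Ci.
have := congr2 +%R J1 Ji; rewrite addrACA subrr addr0 [RHS]addrACA subrr addr0.
rewrite -[LHS]mulr2n -[RHS]mulr2n -[LHS]scaler_nat -[RHS]scaler_nat.
by move/scalerI => -> //; rewrite pnatr_eq0.
Qed.

(** * Bilinear maps, sums of elementary tensors, sesquilinear extensions *)

Section Bilinear.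
Context {K : fieldType} {U V : vectType K} {W : lmodType K}.
Context {f : U -> V -> W} (f_bilin : bilin f).

Lemma bilin_suml I (r : seq I) (u : I -> U) v :
  f (\sum_(i <- r) u i) v = \sum_(i <- r) f (u i) v.
Proof.
have [g gE] := linear_bundle (f_bilin.2 v); rewrite (congr1 (@^~ _) gE) linear_sum.
by rewrite -gE.
Qed.

Lemma bilin_sumr I (r : seq I) u (v : I -> V) :
  f u (\sum_(i <- r) v i) = \sum_(i <- r) f u (v i).
Proof.
by have [g ->] := linear_bundle (f_bilin.1 u); rewrite linear_sum.
Qed.

Lemma bilinZl a u v : f (a *: u) v = a *: f u v.
Proof.
have [g gE] := linear_bundle (f_bilin.2 v); rewrite (congr1 (@^~ _) gE) linearZ.
by rewrite -gE.
Qed.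

Lemma bilinZr a u v : f u (a *: v) = a *: f u v.
Proof.
by have [g ->] := linear_bundle (f_bilin.1 u); rewrite linearZ.
Qed.

End Bilinear.

Section TensorSums.
Context {K : fieldType} {U V : vectType K}.
Variables (n : nat) (u : 'I_n -> U) (v : 'I_n -> V).

Lemma tlift_sum_tens (W : lmodType K) (f : U -> V -> W) :
  bilin f -> tlift f (\sum_i tens (u i) (v i)) = \sum_i f (u i) (v i).
Proof.
by move=> fb; rewrite linear_sum; apply: eq_bigr => i _; rewrite /= tlift_tens.
Qed.

Lemma tmap_bilin (U' V' : vectType K) (f : U -> U') (g : V -> V') :
  linear f -> linear g -> bilin (fun a b => tens (f a) (g b)).
Proof.
move=> fL gL; split=> [a k b b'|b k a a'].
  by rewrite gL (tens_bilin _ _).1.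
by rewrite fL (tens_bilin _ _).2.
Qed.

Lemma tmap_sum_tens (U' V' : vectType K) (f : U -> U') (g : V -> V') :
    linear f -> linear g ->
  tmap f g (\sum_i tens (u i) (v i)) = \sum_i tens (f (u i)) (g (v i)).
Proof. by move=> fL gL; rewrite /tmap tlift_sum_tens //; exact: tmap_bilin. Qed.

End TensorSums.

(** One summand for each row of the coordinate matrix. Identities between tensors are reduced to
    finite sums of elementary ones in this way. *)
Lemma tensor_sum_tens (K : fieldType) (U V : vectType K) (T : tensor U V) :
  exists n (u : 'I_n -> U) (v : 'I_n -> V), T = \sum_i tens (u i) (v i).
Proof.
exists (\dim {:U}), (@bvec _ U), (fun i => \sum_j tcoef T i j *: bvec j).
rewrite [LHS]tens_bvec; apply: eq_bigr => i _.
rewrite (bilin_sumr (tens_bilin U V)); apply: eq_bigr => j _.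
by rewrite (bilinZr (tens_bilin U V)).
Qed.

Section Sesquilinear.
Context {R : realType} {U V : vectType R[i]} {W : lmodType R[i]}.
Variable F : U -> V -> U -> V -> W.
Implicit Types S T : tensor U V.

Lemma tsesqDl k S S' T :
  tsesq F (k *: S + S') T = k^* *: tsesq F S T + tsesq F S' T.
Proof.
rewrite /tsesq; do 4!(rewrite scaler_sumr -big_split; apply: eq_bigr => ? _ /=).
by rewrite /tcoef !mxE rmorphD rmorphM mulrDl scalerDl scalerA mulrA.
Qed.

Lemma tsesqDr k S T T' :
  tsesq F S (k *: T + T') = k *: tsesq F S T + tsesq F S T'.
Proof.
rewrite /tsesq; do 4!(rewrite scaler_sumr -big_split; apply: eq_bigr => ? _ /=).
by rewrite /tcoef !mxE mulrDr scalerDl scalerA mulrCA.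
Qed.

Lemma tsesqr_linear S : linear (tsesq F S).
Proof. by move=> k T T'; exact: tsesqDr. Qed.

Lemma tsesq_suml I (r : seq I) (S : I -> tensor U V) T :
  tsesq F (\sum_(i <- r) S i) T = \sum_(i <- r) tsesq F (S i) T.
Proof.
apply: (big_morph (fun S => tsesq F S T)) => [S1 S2|].
  by rewrite -[S1]scale1r tsesqDl conjC1 !scale1r.
have := tsesqDl (-1) 0 0 T.
by rewrite scaler0 addr0 rmorphN1 scaleN1r addNr.
Qed.

Lemma tsesq_sumr I (r : seq I) S (T : I -> tensor U V) :
  tsesq F S (\sum_(i <- r) T i) = \sum_(i <- r) tsesq F S (T i).
Proof. by have [g ->] := linear_bundle (tsesqr_linear S); rewrite linear_sum. Qed.

Lemma tsesqZr k S T : tsesq F S (k *: T) = k *: tsesq F S T.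
Proof. by have [g ->] := linear_bundle (tsesqr_linear S); rewrite linearZ. Qed.

Lemma tsesqZl k S T : tsesq F (k *: S) T = k^* *: tsesq F S T.
Proof.
have := tsesqDl k S 0 T; rewrite addr0 => ->.
by have := tsesq_suml [::] id T; rewrite !big_nil => ->; rewrite addr0.
Qed.

End Sesquilinear.

(* For the canonical element [m^* 1 = \sum_i p i ⊗ q i] this says that
   [(psi (c _) ⊗ id) (m^* 1) = c]. *)
Definition dual_frame (R : realType) (B : fdCstarAlgType R)
    (psi : {linear B -> R[i]^o}) n (p q : 'I_n -> B) :=
  forall c, \sum_i psi (c ⋅ p i) *: q i = c.

Lemma cmul_bilin (R : realType) (B : fdCstarAlgType R) : bilin (@cmul R B).
Proof. by split; [exact: cmul_linearr | exact: cmul_linearl]. Qed.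

(** * The canonical element m^*(1) and its symmetries *)

Section DualFrame.
Context {R : realType} {B : fdCstarAlgType R} {psi : {linear B -> R[i]^o}}.
Hypothesis hpsi : faithful_state psi.

Lemma state_star x : psi x^⋆ = (psi x)^*.
Proof.
have [_ psi_ge0 _] := hpsi.
apply: (hermitian_of_positive (J := fun a : R[i]^o => a^* : R[i]^o)).
- by move=> a b; rewrite rmorphD.
- by move=> a b; rewrite /GRing.scale /= rmorphM.
- by move=> {}x; apply/CrealP/ger0_real/psi_ge0.
Qed.

(** Faithfulness applied to x - y, with c = (x - y)^⋆. *)
Lemma state_nondegenerate x y : (forall c, psi (c ⋅ x) = psi (c ⋅ y)) -> x = y.
Proof.
have [_ _ psi_faithful] := hpsi => xy; apply/eqP; rewrite -subr_eq0; apply/eqP.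
by apply: psi_faithful; rewrite cmulBr linearB xy subrr.
Qed.

Section Frame.
Context {n : nat} {p q : 'I_n -> B} (pq : dual_frame psi p q).

(** Pairing with c and contracting the frame on the other leg gives psi (c d) for both sides, so
    nondegeneracy applies. *)
Lemma dual_frame_flip d : \sum_i psi (q i ⋅ d) *: p i = d.
Proof.
apply: state_nondegenerate => c; rewrite cmul_sumr linear_sum.
rewrite -[in RHS](pq c) cmul_suml linear_sum; apply: eq_bigr => i _.
by rewrite cmulZr cmulZl !linearZ /=; exact: mulrC.
Qed.

(* By [dual_frame_flip], an element of B ⊗ B is determined by its slices
   [(psi (c _) ⊗ id)]. *)
Lemma bilin_eq_of_slices (W : lmodType R[i]) (f : B -> B -> W) k l
    (a b : 'I_k -> B) (c d : 'I_l -> B) : bilin f ->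
    (forall x, \sum_i psi (x ⋅ a i) *: b i = \sum_j psi (x ⋅ c j) *: d j) ->
  \sum_i f (a i) (b i) = \sum_j f (c j) (d j).
Proof.
move=> fb slices.
have expand m (g h : 'I_m -> B) : \sum_i f (g i) (h i) =
    \sum_j f (p j) (\sum_i psi (q j ⋅ g i) *: h i).
  under [RHS]eq_bigr => j _ do rewrite (bilin_sumr fb).
  rewrite exchange_big /=; apply: eq_bigr => i _.
  rewrite -[in LHS](dual_frame_flip (g i)) (bilin_suml fb); apply: eq_bigr => j _.
  by rewrite (bilinZl fb) (bilinZr fb).
rewrite (expand _ a b) (expand _ c d); apply: eq_bigr => j _.
by rewrite slices.
Qed.

(** Both sides have slice c x at c. This moves a factor from one leg of m^*(1) to the other with no
    modular twist. *)
Lemma dual_frame_mul (W : lmodType R[i]) (f : B -> B -> W) x : bilin f ->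
  \sum_i f (x ⋅ p i) (q i) = \sum_i f (p i) (q i ⋅ x).
Proof.
move=> fb; apply: bilin_eq_of_slices => // c.
under eq_bigr do rewrite cmulA.
rewrite pq -{1}(pq c) cmul_suml; apply: eq_bigr => i _.
by rewrite cmulZl.
Qed.

(** m^*(1) is fixed by a ⊗ b ↦ b^⋆ ⊗ a^⋆: the slice of the left side at c is the adjoint of
    [dual_frame_flip] at c^⋆. *)
Lemma dual_frame_star (W : lmodType R[i]) (f : B -> B -> W) : bilin f ->
  \sum_i f (q i)^⋆ (p i)^⋆ = \sum_i f (p i) (q i).
Proof.
move=> fb; apply: bilin_eq_of_slices => // c; rewrite pq.
rewrite -[RHS]cstarK -[in RHS](dual_frame_flip c^⋆) cstar_sum.
by apply: eq_bigr => i _; rewrite cstarZ -state_star cstarM cstarK.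
Qed.

End Frame.

(** Testing the adjoint relation of m^* on c^⋆ ⊗ d^⋆ and conjugating shows that both sides agree
    under psi (d _). *)
Lemma mult_adj_slices n (a b : 'I_n -> B) x c :
    mult_adj psi x = \sum_i tens (a i) (b i) ->
  \sum_i psi (c ⋅ a i) *: b i = c ⋅ x.
Proof.
move=> xE; apply: state_nondegenerate => d.
have := mult_adjE hpsi x (tens c^⋆ d^⋆).
rewrite xE /ip2 tsesq_suml /mult tlift_tens; last exact: cmul_bilin.
have tE i : tsesq (W := R[i]^o) (fun a b c d => ip psi a c * ip psi b d)
   (tens (a i) (b i)) (tens c^⋆ d^⋆) = ip psi (a i) c^⋆ * ip psi (b i) d^⋆.
  apply: tsesq_tens => [k u u' ? ? ?|k u u' ? ? ?|? ?].
  - by rewrite ipDl mulrDl -mulrA.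
  - by rewrite ipDl mulrDr mulrCA.
  - split=> ? k ? ?; first by rewrite ipDr mulrDr mulrCA.
    by rewrite ipDr mulrDl -mulrA.
under eq_bigr do rewrite tE /ip -!cstarM !state_star -rmorphM.
rewrite -rmorph_sum /ip -!cstarM state_star => /(can_inj conjCK).
rewrite cmul_sumr linear_sum -cmulA => <-; apply: eq_bigr => i _.
by rewrite cmulZr linearZ.
Qed.

(** Any decomposition of m^*(1) is a dual frame, by its slices. The slice of m^*(x) at c is that of
    m^*(1) at c x, whence the formula for m^*(x). *)
Lemma dual_frame_exists : exists n (p q : 'I_n -> B), dual_frame psi p q /\
  forall x, mult_adj psi x = \sum_i tens (x ⋅ p i) (q i).
Proof.
have [n [p [q pqE]]] := tensor_sum_tens (mult_adj psi cone).
have pq : dual_frame psi p q.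
  by move=> c; rewrite (mult_adj_slices _ pqE) cmulx1.
exists n, p, q; split=> // x.
have [m [a [b xE]]] := tensor_sum_tens (mult_adj psi x).
rewrite xE; apply: (bilin_eq_of_slices pq (tens_bilin _ _)) => c.
rewrite (mult_adj_slices _ xE) -{1}(pq (c ⋅ x)).
by apply: eq_bigr => i _; rewrite cmulA.
Qed.

End DualFrame.

(** * Frames in Hilbert modules and the induced map on compact operators *)

Section HilbertModule.
Context {R : realType} {B : fdCstarAlgType R} (X : correspondence B).

(** The algebraic axioms of a right Hilbert module; linearity of the inner product in the second
    variable and its symmetry give conjugate linearity in the first. *)
Definition hilbert_module :=
  [/\ bilin (@ract R B X),
     forall (xi : X) b c, ract (ract xi b) c = ract xi (b ⋅ c),
     forall xi : X, linear (corr_ip xi),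
     forall xi eta : X, (corr_ip xi eta)^⋆ = corr_ip eta xi &
     forall (xi eta : X) b, corr_ip xi (ract eta b) = corr_ip xi eta ⋅ b].

(** A reconstruction formula: the rank-one operators θ_{u_i, w_i} sum to the identity. *)
Definition module_frame n (u w : 'I_n -> X) :=
  forall xi, \sum_i ract (u i) (corr_ip (w i) xi) = xi.

Hypothesis hX : hilbert_module.

Lemma thetaE (xi eta zeta : X) :
  theta xi eta zeta = ract xi (corr_ip eta zeta).
Proof.
have [[ractr _] _ ip_lin _ _] := hX.
have theta_lin : linear (fun zeta : X => ract xi (corr_ip eta zeta)).
  by move=> k z z'; rewrite ip_lin ractr.
have [g gE] := linear_bundle theta_lin.
by rewrite /theta gE lfunE -gE.
Qed.

Lemma theta_sumE n (u w : 'I_n -> X) xi :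
  (\sum_i theta (u i) (w i)) xi = \sum_i ract (u i) (corr_ip (w i) xi).
Proof. by rewrite sum_lfunE; apply: eq_bigr => i _; rewrite thetaE. Qed.

Lemma compact_op_ract (k : 'End(X)) xi b :
  compact_op k -> k (ract xi b) = ract (k xi) b.
Proof.
have [ract_bilin ractA _ _ ip_ract] := hX.
move=> [n [u [w ->]]]; rewrite !theta_sumE (bilin_suml ract_bilin).
by apply: eq_bigr => i _; rewrite ip_ract ractA.
Qed.

Section Representation.
Context {D : cstarAlgType R} { pi : B -> D} {t : X -> D}.
Hypothesis rep : representation pi t.

(** If d is the difference of the two sides, all four terms of d^⋆ d equal pi (b^⋆ <ξ,ξ> b) up to
    sign and cancel; the C*-identity gives d = 0. *)
Lemma representation_ract xi b : t xi ⋅ pi b = t (ract xi b).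
Proof.
have [[_ piM pi_star] _ _ ip_t] := rep; have [_ _ _ ip_star ip_ract] := hX.
have ip_ractl (eta zeta : X) : corr_ip (ract eta b) zeta = b^⋆ ⋅ corr_ip eta zeta.
  by rewrite -[LHS]ip_star ip_ract cstarM ip_star.
apply/eqP; rewrite -subr_eq0; apply/eqP/cstar_mul_eq0.
rewrite cstarB cmulBl !cmulBr cstarM -!cmulA (cmulA (t xi)^⋆ (t xi)) !ip_t.
rewrite (cmulA (t _)^⋆ (t _) (pi b)) ip_t -pi_star -!piM !ip_ract !ip_ractl.
by rewrite !cmulA !subrr.
Qed.

Section Frame.
Context {n : nat} {u w : 'I_n -> X}.
Hypotheses (uw : module_frame u w) (wu : module_frame w u).

(** The explicit form of ψ_t: a compact k is the sum of the operators θ_{k u_i, w_i}. *)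
Definition frame_rep (k : 'End(X)) : D := \sum_i t (k (u i)) ⋅ (t (w i))^⋆.

Lemma frame_expand_star xi :
  \sum_i pi (corr_ip xi (u i)) ⋅ (t (w i))^⋆ = (t xi)^⋆.
Proof.
have [[_ _ pi_star] t_lin _ _] := rep; have [_ _ _ ip_star _] := hX.
rewrite -[in RHS](wu xi); have [g gE] := linear_bundle t_lin.
rewrite {2}gE linear_sum -gE cstar_sum; apply: eq_bigr => i _.
by rewrite -representation_ract cstarM -pi_star ip_star.
Qed.

Lemma frame_rep_apply k xi : compact_op k -> frame_rep k ⋅ t xi = t (k xi).
Proof.
move=> k_comp; have [_ t_lin _ ip_t] := rep; have [g gE] := linear_bundle t_lin.
rewrite -[in RHS](uw xi) gE !linear_sum -gE cmul_suml; apply: eq_bigr => i _.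
by rewrite -cmulA ip_t /= compact_op_ract // representation_ract.
Qed.

Lemma frame_compact_rep : compact_rep t frame_rep.
Proof.
have [[_ _ pi_star] t_lin _ ip_t] := rep.
have [g gE] := linear_bundle t_lin.
split=> [a k l _ _|k l k_comp _|k l _ _ kl|xi eta].
- rewrite scaler_sumr -big_split; apply: eq_bigr => i _ /=.
  by rewrite add_lfunE scale_lfunE t_lin cmulDl cmulZl.
- rewrite [in RHS]/frame_rep cmul_sumr; apply: eq_bigr => i _.
  by rewrite comp_lfunE cmulA frame_rep_apply.
(* Each (t (k u_i))^⋆ is expanded in the frame, k crosses the inner product as l, and the sum over i
   collapses by the flipped frame. *)
- rewrite [RHS]cstar_sum.
  under [RHS]eq_bigr => i _ do
    rewrite cstarM cstarK -frame_expand_star cmul_sumr.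
  rewrite exchange_big /=; apply: eq_bigr => j _.
  under [RHS]eq_bigr => i _ do
    rewrite kl cmulA representation_ract.
  by rewrite -cmul_suml gE -linear_sum wu.
- under [LHS]eq_bigr => i _ do
    rewrite thetaE -representation_ract -cmulA.
  by rewrite -cmul_sumr frame_expand_star.
Qed.

End Frame.
End Representation.
End HilbertModule.

(** * Units of two-sided ideals *)

Section IdealUnit.
Context {R : realType} {B : fdCstarAlgType R} {psi : {linear B -> R[i]^o}}.
Hypothesis hpsi : faithful_state psi.

(** The map [f] pairing with a basis of U is injective on U by faithfulness, hence onto by
    dimension; z is a preimage in U of f x. *)
Lemma orthogonal_projection (U : {vspace B}) x :
  exists2 z, z \in U & forall u, u \in U -> psi (u^⋆ ⋅ z) = psi (u^⋆ ⋅ x).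
Proof.
pose b (k : 'I_(\dim U)) := (vbasis U)`_k.
pose f y : 'rV[R[i]]_(\dim U) := \row_k psi ((b k)^⋆ ⋅ y).
have f_lin : linear f.
  by move=> a y y'; apply/rowP => k; rewrite !mxE cmulDr cmulZr linearP.
have [g gE] := linear_bundle f_lin.
have fP y y' : f y = f y' ->
    forall u, u \in U -> psi (u^⋆ ⋅ y) = psi (u^⋆ ⋅ y').
  move=> fyy' u uU; rewrite (coord_vbasis uU) cstar_sum !cmul_suml !linear_sum.
  apply: eq_bigr => k _; rewrite cstarZ !cmulZl !linearZ /=.
  by have /rowP/(_ k) := fyy'; rewrite !mxE => ->.
have inj : (U :&: lker (linfun g))%VS = 0%VS.
  apply/eqP; rewrite -subv0; apply/subvP => y /memv_capP[yU].
  rewrite memv_ker lfunE /= -gE memv0 => /eqP fy0; apply/eqP.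
  have f0 : f 0 = 0 by rewrite gE linear0.
  have [_ _ psi_faithful] := hpsi; apply: psi_faithful.
  by rewrite (fP y 0) ?cmulx0 ?linear0 // f0.
have full : (linfun g @: U)%VS = fullv.
  apply/eqP; rewrite -(dimv_leqif_eq (subvf _)) limg_dim_eq //.
  by rewrite dimvf /dim /= mul1n.
have : f x \in (linfun g @: U)%VS by rewrite full memvf.
case/memv_imgP => z zU; rewrite lfunE /= -gE => fxz; exists z => //.
exact: fP.
Qed.

(* The unit is the orthogonal projection of 1 onto the ideal. *)
Lemma ideal_unit (I : {vspace B}) :
    (forall x y, y \in I -> x ⋅ y \in I) -> (forall x y, x \in I -> x ⋅ y \in I) ->
    (forall x, x \in I -> x^⋆ \in I) ->
  exists2 z, z \in I &
    [/\ z ⋅ z = z, z^⋆ = z, forall x, z ⋅ x = x ⋅ z &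
        forall x, x \in I -> x ⋅ z = x].
Proof.
move=> I_left I_right I_star; have [z zI zP] := orthogonal_projection I cone.
have unit_r x : x \in I -> x ⋅ z = x.
  move=> xI; apply: (state_nondegenerate hpsi) => c.
  have := zP (c ⋅ x)^⋆; rewrite cstarK cmulA cmulx1; apply.
  exact/I_star/I_left.
have zz : z^⋆ ⋅ z = z^⋆ by exact/unit_r/I_star.
have z_star : z^⋆ = z by rewrite -[RHS]cstarK -{2}zz cstarM cstarK.
exists z => //; split=> // [|x]; first by rewrite -{1}z_star zz.
(* Centrality: z x = z x z since z x lies in I, and the adjoint of the same identity for x^⋆ gives x
   z = z x z. *)
rewrite -[LHS](unit_r _ (I_right _ x zI)).
have := congr1 (@cstar R B) (unit_r _ (I_right _ x^⋆ zI)).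
by rewrite !cstarM cstarK z_star cmulA.
Qed.

End IdealUnit.

(** * The bimodule B ⊗_ψ B and its inner product *)

Section TensorModule.
Context {R : realType} {B : fdCstarAlgType R} {psi : {linear B -> R[i]^o}}.
Hypothesis hpsi : faithful_state psi.
Implicit Types S T : tensor B B.

Lemma blact_bilin : bilin (@blact R B).
Proof.
split=> [x k T T'|T k x x']; first exact: linearP.
rewrite /blact /tmap -tlift_lin; congr tlift.
by apply/funext => a; apply/funext => b; rewrite cmulDl cmulZl (tens_bilin _ _).2.
Qed.

Lemma bract_bilin : bilin (@bract R B).
Proof.
split=> [T k y y'|y k T T']; last exact: linearP.
rewrite /bract /tmap -tlift_lin; congr tlift.
by apply/funext => a; apply/funext => b; rewrite cmulDr cmulZr (tens_bilin _ _).1.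
Qed.

Lemma blact_sum_tens x n (a b : 'I_n -> B) :
  blact x (\sum_i tens (a i) (b i)) = \sum_i tens (x ⋅ a i) (b i).
Proof. by rewrite /blact tmap_sum_tens //; exact: cmul_linearr. Qed.

Lemma bract_sum_tens y n (a b : 'I_n -> B) :
  bract (\sum_i tens (a i) (b i)) y = \sum_i tens (a i) (b i ⋅ y).
Proof. by rewrite /bract tmap_sum_tens //; exact: cmul_linearl. Qed.

Lemma blact1 T : blact cone T = T.
Proof.
have [n [a [b ->]]] := tensor_sum_tens T; rewrite blact_sum_tens.
by under eq_bigr do rewrite cmul1x.
Qed.

Lemma bract1 T : bract T cone = T.
Proof.
have [n [a [b ->]]] := tensor_sum_tens T; rewrite bract_sum_tens.
by under eq_bigr do rewrite cmulx1.
Qed.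

Lemma blactA x y T : blact x (blact y T) = blact (x ⋅ y) T.
Proof.
have [n [a [b ->]]] := tensor_sum_tens T; rewrite !blact_sum_tens.
by under eq_bigr do rewrite cmulA.
Qed.

Lemma bractA T x y : bract (bract T x) y = bract T (x ⋅ y).
Proof.
have [n [a [b ->]]] := tensor_sum_tens T; rewrite !bract_sum_tens.
by under eq_bigr do rewrite -cmulA.
Qed.

Lemma blact_bract x T y : blact x (bract T y) = bract (blact x T) y.
Proof.
have [n [a [b ->]]] := tensor_sum_tens T.
by rewrite !(bract_sum_tens, blact_sum_tens).
Qed.

Lemma mult_sum_tens n (a b : 'I_n -> B) :
  mult (\sum_i tens (a i) (b i)) = \sum_i a i ⋅ b i.
Proof. by rewrite /mult tlift_sum_tens //; exact: cmul_bilin. Qed.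

Lemma bip_linear S : linear (bip psi S).
Proof. exact: tsesqr_linear. Qed.

Lemma bipZl k S T : bip psi (k *: S) T = k^* *: bip psi S T.
Proof. exact: tsesqZl. Qed.

Lemma bipZr k S T : bip psi S (k *: T) = k *: bip psi S T.
Proof. exact: tsesqZr. Qed.

Lemma bip_sum_tens n m (a b : 'I_n -> B) (c d : 'I_m -> B) :
  bip psi (\sum_i tens (a i) (b i)) (\sum_j tens (c j) (d j)) =
  \sum_i \sum_j psi ((a i)^⋆ ⋅ c j) *: ((b i)^⋆ ⋅ d j).
Proof.
rewrite /bip tsesq_suml; apply: eq_bigr => i _.
rewrite tsesq_sumr; apply: eq_bigr => j _; apply: tsesq_tens.
- by move=> k u u' ? ? ?; rewrite cstarD cstarZ cmulDl cmulZl linearP scalerDl scalerA.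
- move=> k u u' ? ? ?; rewrite cstarD cstarZ cmulDl cmulZl scalerDr !scalerA.
  by congr (_ *: _ + _); exact: mulrC.
- split=> ? k ? ?; rewrite cmulDr cmulZr.
    by rewrite scalerDr !scalerA; congr (_ *: _ + _); exact: mulrC.
  by rewrite linearP scalerDl scalerA.
Qed.

Lemma bip_star S T : (bip psi S T)^⋆ = bip psi T S.
Proof.
have [n [a [b ->]]] := tensor_sum_tens S; have [m [c [d ->]]] := tensor_sum_tens T.
rewrite !bip_sum_tens exchange_big cstar_sum; apply: eq_bigr => j _ /=.
rewrite cstar_sum; apply: eq_bigr => i _.
by rewrite cstarZ cstarM cstarK -(state_star hpsi) cstarM cstarK.
Qed.

Lemma bip_bract S T y : bip psi S (bract T y) = bip psi S T ⋅ y.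
Proof.
have [n [a [b ->]]] := tensor_sum_tens S; have [m [c [d ->]]] := tensor_sum_tens T.
rewrite bract_sum_tens !bip_sum_tens cmul_suml; apply: eq_bigr => j _ /=.
by rewrite cmul_suml; apply: eq_bigr => i _; rewrite cmulZl cmulA.
Qed.

End TensorModule.

(** The 1 × 1 case of complete positivity writes A (x^⋆ x) as y^⋆ y, which is self-adjoint;
    polarization does the rest. *)
Lemma completely_positive_star (R : realType) (B : fdCstarAlgType R)
    (A : {linear B -> B}) :
  completely_positive A -> forall x, A x^⋆ = (A x)^⋆.
Proof.
move=> A_cp; apply: (hermitian_of_positive (@cstarD R B) (@cstarZ R B)) => x.
have /A_cp[Y /matrixP/(_ 0 0)] : mxpositive (\matrix_(i < 1, j < 1) (x^⋆ ⋅ x)).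
  by exists (const_mx x); apply/matrixP => i j; rewrite !mxE big_ord1 !mxE.
by rewrite !mxE big_ord1 => ->; rewrite cstarM cstarK.
Qed.

(* The correspondence generated by a vector [eps] under commuting left and right
   actions; [edge_corr] is an instance of [cyclic_corr] by conversion. Keeping the
   ambient space abstract prevents unification from computing with tensors. *)
Section CyclicCorrespondence.
Context {R : realType} {B : fdCstarAlgType R} {T : vectType R[i]}.
Context {l : B -> T -> T} {r : T -> B -> T} {ip : T -> T -> B}.
Hypotheses (l_bilin : bilin l) (r_bilin : bilin r).
Hypotheses (lA : forall x y xi, l x (l y xi) = l (x ⋅ y) xi)
  (rA : forall xi x y, r (r xi x) y = r xi (x ⋅ y))
  (lrA : forall x xi y, l x (r xi y) = r (l x xi) y).
Hypotheses (ip_linear : forall xi, linear (ip xi))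
  (ip_star : forall xi eta, (ip xi eta)^⋆ = ip eta xi)
  (ip_r : forall xi eta y, ip xi (r eta y) = ip xi eta ⋅ y).
Context {eps : T} {E : {vspace T}}.
Hypothesis EP : forall xi, reflect
  (exists n (x y : 'I_n -> B), xi = \sum_i r (l (x i) eps) (y i)) (xi \in E).

Definition cyclic_corr : correspondence B := @Correspondence R B (subvs_of E)
  (fun x => linfun (fun xi : subvs_of E => vsproj E (l x (vsval xi))))
  (fun xi y => vsproj E (r (vsval xi) y))
  (fun xi eta => ip (vsval xi) (vsval eta)).

Let X := cyclic_corr.

Definition cyclic_gen (x y : B) : X := vsproj E (r (l x eps) y).

Lemma val_cyclic_gen x y : vsval (cyclic_gen x y) = r (l x eps) y.
Proof.
apply: vsprojK; apply/EP.
by exists 1%N, (fun=> x), (fun=> y); rewrite big_ord1.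
Qed.

Lemma val_cyclicP k (xi eta : X) : vsval (k *: xi + eta) = k *: vsval xi + vsval eta.
Proof. exact: linearP. Qed.

Lemma val_cyclic_sum n (xi : 'I_n -> X) : vsval (\sum_i xi i) = \sum_i vsval (xi i).
Proof. exact: linear_sum. Qed.

Lemma cyclic_gen_bilin : bilin cyclic_gen.
Proof.
split=> [x k y y'|y k x x']; apply: subvs_inj; rewrite val_cyclicP !val_cyclic_gen.
  by rewrite r_bilin.1.
by rewrite l_bilin.2 r_bilin.2.
Qed.

Lemma cyclic_gen_span (xi : X) :
  exists n (x y : 'I_n -> B), xi = \sum_i cyclic_gen (x i) (y i).
Proof.
have /EP[n [x [y xiE]]] := subvsP xi.
exists n, x, y; apply: subvs_inj; rewrite xiE val_cyclic_sum.
by apply: eq_bigr => i _; rewrite val_cyclic_gen.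
Qed.

(** The left action commutes with the right one and so sends x·eps·y to another such vector; hence
    it preserves E and the projection acts trivially. *)
Lemma val_cyclic_lact x (xi : X) : vsval (lact X x xi) = l x (vsval xi).
Proof.
have lact_lin : linear (fun xi : subvs_of E => vsproj E (l x (vsval xi))).
  by move=> k z z'; rewrite linearP l_bilin.1 linearP.
have [g gE] := linear_bundle lact_lin; rewrite /= gE lfunE -gE.
have [n [y [z ->]]] := cyclic_gen_span xi.
apply: vsprojK; apply/EP; exists n, (fun i => x ⋅ y i), z.
rewrite val_cyclic_sum (bilin_sumr l_bilin); apply: eq_bigr => i _.
by rewrite val_cyclic_gen lrA lA.
Qed.

Lemma val_cyclic_ract (xi : X) y : vsval (ract xi y) = r (vsval xi) y.
Proof.
have [n [x [z ->]]] := cyclic_gen_span xi.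
apply: vsprojK; apply/EP; exists n, x, (fun i => z i ⋅ y).
rewrite val_cyclic_sum (bilin_suml r_bilin); apply: eq_bigr => i _.
by rewrite val_cyclic_gen rA.
Qed.

Lemma cyclic_lact_gen x y z : lact X x (cyclic_gen y z) = cyclic_gen (x ⋅ y) z.
Proof. by apply: subvs_inj; rewrite val_cyclic_lact !val_cyclic_gen lrA lA. Qed.

Lemma cyclic_ract_gen x y z : ract (cyclic_gen x y) z = cyclic_gen x (y ⋅ z).
Proof. by apply: subvs_inj; rewrite val_cyclic_ract !val_cyclic_gen rA. Qed.

Lemma cyclic_ip_gen x y x' y' : corr_ip (cyclic_gen x y) (cyclic_gen x' y') =
  ip (r (l x eps) y) (r (l x' eps) y').
Proof. by rewrite /= !val_cyclic_gen. Qed.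

Lemma cyclic_hilbert_module : hilbert_module X.
Proof.
split.
- split=> [xi k y y'|y k xi xi']; apply: subvs_inj;
    rewrite val_cyclicP !val_cyclic_ract.
    by rewrite r_bilin.1.
  by rewrite val_cyclicP r_bilin.2.
- by move=> xi y z; apply: subvs_inj; rewrite !val_cyclic_ract rA.
- move=> xi k eta zeta; rewrite -[LHS]/(ip _ (vsval (k *: eta + zeta))).
  by rewrite val_cyclicP ip_linear.
- by move=> xi eta; exact: ip_star.
- by move=> xi eta y; rewrite [LHS]/= val_cyclic_ract ip_r.
Qed.

End CyclicCorrespondence.

(** * Inner products and reconstruction for the vectors x·ε·y *)

Section EdgeCorrespondence.
Context {R : realType} {B : fdCstarAlgType R}.
Context {psi : {linear B -> R[i]^o}} {A : {linear B -> B}} {delta : R}.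
Hypotheses (hG : quantum_graph psi A delta) (hA : completely_positive A).

Let hpsi : faithful_state psi.
Proof. by case: hG. Qed.

Let d2 : R[i] := delta%:C%C ^+ 2.

Lemma delta_neq0 : delta%:C%C != 0 :> R[i].
Proof. by have [_ delta_gt0 _ _] := hG; rewrite gt_eqF // ltcR. Qed.

Lemma delta2_neq0 : d2 != 0.
Proof. by rewrite expf_neq0 // delta_neq0. Qed.

Lemma delta2V_conj : (d2^-1)^* = d2^-1.
Proof.
apply: conj_Creal; rewrite realV; apply: realX; apply/complex_realP.
by exists delta.
Qed.

Let eps := edge_indicator psi A delta.

Section Frame.
Context {n : nat} {p q : 'I_n -> B}.
Hypotheses (pq : dual_frame psi p q)
  (mE : forall x, mult_adj psi x = \sum_i tens (x ⋅ p i) (q i)).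

(** Moving y to the first leg turns the left side into m (A ⊗ A) m^* evaluated at x y. *)
Lemma adjacency_frame x y : \sum_i A (x ⋅ p i) ⋅ A (q i ⋅ y) = d2 *: A (x ⋅ y).
Proof.
have AA_bilin : bilin (fun u v => A (x ⋅ u) ⋅ A v).
  split=> [u k v v'|v k u u']; first by rewrite linearP cmulDr cmulZr.
  by rewrite cmulDr cmulZr linearP cmulDl cmulZl.
rewrite -(dual_frame_mul hpsi pq y AA_bilin).
have [_ _ _ <-] := hG; rewrite mE tmap_sum_tens; try exact: linearP.
by rewrite mult_sum_tens; under eq_bigr do rewrite cmulA.
Qed.

Lemma edge_vector_sum x y :
  bract (blact x eps) y = d2^-1 *: \sum_i tens (x ⋅ p i) (A (q i) ⋅ y).
Proof.
rewrite /eps /edge_indicator mE tmap_sum_tens //; last exact: linearP.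
rewrite (bilinZr blact_bilin) (bilinZl bract_bilin).
rewrite blact_sum_tens bract_sum_tens; congr (_ *: _).
by apply: eq_bigr => i _; rewrite cmul1x.
Qed.

(** In the double sum over the frame, the sum over j contracts by [pq] and leaves A (q_i^⋆) A (p_i^⋆
    x^⋆ x'). The star symmetry of m^*(1) replaces q_i^⋆ ⊗ p_i^⋆ by p_i ⊗ q_i, and the adjacency
    relation absorbs one factor δ^-2. *)
Lemma edge_ip x y x' y' :
  bip psi (bract (blact x eps) y) (bract (blact x' eps) y') =
  d2^-1 *: (y^⋆ ⋅ A (x^⋆ ⋅ x') ⋅ y').
Proof.
rewrite (congr2 (bip psi) (edge_vector_sum x y) (edge_vector_sum x' y')).
rewrite bipZl bipZr bip_sum_tens delta2V_conj; congr (_ *: _).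
pose f u v := y^⋆ ⋅ (A u ⋅ A (v ⋅ (x^⋆ ⋅ x'))) ⋅ y'.
have fb : bilin f.
  split=> [u k v v'|v k u u']; rewrite /f.
    by rewrite cmulDl cmulZl linearP !cmulDr cmulDl !cmulZr cmulZl.
  by rewrite linearP cmulDl cmulDr cmulDl cmulZl cmulZr cmulZl.
transitivity (d2^-1 *: \sum_i f (q i)^⋆ (p i)^⋆).
  congr (_ *: _); apply: eq_bigr => i _; rewrite /f.
  have {1}-> : (p i)^⋆ ⋅ (x^⋆ ⋅ x') =
      \sum_j psi ((x ⋅ p i)^⋆ ⋅ (x' ⋅ p j)) *: q j.
    rewrite -[LHS]pq; apply: eq_bigr => j _.
    by rewrite cstarM !cmulA.
  rewrite linear_sum !cmul_sumr cmul_suml; apply: eq_bigr => j _.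
  rewrite linearZ /= !cmulZr cmulZl [(A _ ⋅ _)^⋆]cstarM.
  by rewrite -(completely_positive_star hA) !cmulA.
rewrite (dual_frame_star hpsi pq fb) /f -cmul_suml -cmul_sumr.
have -> : \sum_i A (p i) ⋅ A (q i ⋅ (x^⋆ ⋅ x')) = d2 *: A (x^⋆ ⋅ x').
  rewrite -[in RHS](cmul1x (x^⋆ ⋅ x')) -adjacency_frame.
  by under [RHS]eq_bigr do rewrite cmul1x.
by rewrite cmulZr cmulZl scalerA mulVf ?scale1r // delta2_neq0.
Qed.

(** Up to a scalar this is the reconstruction formula for x·ε·y, with the inner products already
    computed. After p_i is moved to the second leg, the sum over i is an instance of
    [adjacency_frame]. *)
Lemma edge_resolution x y :
  \sum_i bract (blact (p i) eps) (A (q i ⋅ x) ⋅ y) = d2 *: bract (blact x eps) y.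
Proof.
under eq_bigr do rewrite edge_vector_sum.
rewrite -scaler_sumr edge_vector_sum scalerA mulrC -scalerA; congr (_ *: _).
have tA_bilin z : bilin (fun u v : B => tens u (A v ⋅ z)).
  split=> [u k v v'|v k u u']; last exact: (tens_bilin _ _).2.
  by rewrite linearP cmulDl cmulZl (tens_bilin _ _).1.
under eq_bigr => i _ do
  rewrite (dual_frame_mul hpsi pq (p i) (tA_bilin (A (q i ⋅ x) ⋅ y))).
rewrite exchange_big (dual_frame_mul hpsi pq x (tA_bilin y)) scaler_sumr.
apply: eq_bigr => j _; rewrite -(bilin_sumr (tens_bilin _ _)).
rewrite -(bilinZr (tens_bilin _ _)) -cmulZl -adjacency_frame cmul_suml.
by under eq_bigr do rewrite cmulA.
Qed.

End Frame.
End EdgeCorrespondence.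

(** * Closed subalgebras fixed by a projection, and extension from generators *)

Section UnitSubalgebra.
Context {R : realType} {D : cstarAlgType R}.

Lemma closed_fixed_points (f : D -> D) (C : R[i]) :
  linear f -> 0 <= C -> (forall x, `|f x| <= C * `|x|) ->
  closed [set x | f x = x]%classic.
Proof.
move=> f_lin C_ge0 f_le.
have g_lin : linear (fun x => f x - x).
  by move=> a x y; rewrite f_lin scalerBr opprD addrACA.
have [g gE] := linear_bundle g_lin.
have -> : [set x | f x = x]%classic = [set x | g x = 0]%classic.
  apply/seteqP; rewrite -gE; split=> x /= => [->|/eqP]; first exact: subrr.
  by rewrite subr_eq0 => /eqP.
apply: (closed_ker (C := C + 1)) => [|x]; first by rewrite addr_ge0.
by rewrite -gE mulrDl mul1r (le_trans (ler_normB _ _)) // lerD2r f_le.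
Qed.

(** Serves to check a unit on generators only: a generating set inside this subalgebra forces it to
    be everything. *)
Lemma unit_for_subalg (e : D) : e^⋆ = e ->
  cstar_subalg [set x : D | e ⋅ x = x /\ x ⋅ e = x]%classic.
Proof.
move=> e_star; split=> /=.
- apply: closedI; apply: (closed_fixed_points (C := `|e|)) => //.
  + exact: cmul_linearr.
  + by move=> x; exact: cnormM.
  + exact: cmul_linearl.
  + by move=> x; rewrite mulrC; exact: cnormM.
- by rewrite cmulx0 cmul0x.
- by move=> a x y [ex xe] [ey ye]; rewrite cmulDr cmulDl cmulZr cmulZl ex xe ey ye.
- by move=> x y [ex xe] [ey ye]; rewrite cmulA ex -cmulA ye.
- by move=> x [ex xe]; split; rewrite -[in LHS]e_star -cstarM ?ex ?xe.
Qed.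

End UnitSubalgebra.

Lemma corr_ip_suml (R : realType) (B : fdCstarAlgType R) (X : correspondence B)
    n (xi : 'I_n -> X) eta : hilbert_module X ->
  corr_ip (\sum_i xi i) eta = \sum_i corr_ip (xi i) eta.
Proof.
move=> [_ _ ip_lin ip_star _]; rewrite -[LHS]ip_star.
have [g gE] := linear_bundle (ip_lin eta).
rewrite gE linear_sum -gE cstar_sum.
by apply: eq_bigr => i _; rewrite ip_star.
Qed.

(** The extension lifts a vector of X through a linear section of U ⊗ V → X and then applies F; the
    last hypothesis says that F kills the kernel, so the choice of section is harmless. *)
Lemma linear_extension (K : fieldType) (U V X : vectType K) (W : lmodType K)
    (gen : U -> V -> X) (F : U -> V -> W) :
    bilin gen -> bilin F ->
    (forall xi, exists n (x : 'I_n -> U) (y : 'I_n -> V),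
       xi = \sum_i gen (x i) (y i)) ->
    (forall n (x : 'I_n -> U) (y : 'I_n -> V),
       \sum_i gen (x i) (y i) = 0 -> \sum_i F (x i) (y i) = 0) ->
  exists t : {linear X -> W}, forall x y, t (gen x y) = F x y.
Proof.
move=> gen_bilin F_bilin gen_span gen0.
pose G := linfun (tlift gen).
have t_lin : linear (fun xi => tlift F (G^-1%VF xi)).
  by move=> a xi eta; rewrite !linearP.
have [t tE] := linear_bundle t_lin; exists t => x y; rewrite -tE.
apply/eqP; rewrite -(tlift_tens x y F_bilin) -subr_eq0 -linearB; apply/eqP.
(* The chosen lift of [gen x y] and the obvious lift x ⊗ y differ by an element of the kernel. *)
have : G (G^-1%VF (gen x y) - tens x y) = 0.
  rewrite linearB /= limg_lfunVK; first by rewrite lfunE /= tlift_tens // subrr.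
  apply/memv_imgP; exists (tens x y); first exact: memvf.
  by rewrite lfunE /= tlift_tens.
have [n [a [b ->]]] := tensor_sum_tens (G^-1%VF (gen x y) - tens x y).
by rewrite lfunE /= !tlift_sum_tens // => /gen0.
Qed.

(** * The local Cuntz-Krieger relations in terms of the frame *)

Section LocalFamily.
Context {R : realType} {B : fdCstarAlgType R}.
Context {psi : {linear B -> R[i]^o}} {A : {linear B -> B}} {delta : R}.
Context {n : nat} {p q : 'I_n -> B}.
Hypothesis mE : forall x, mult_adj psi x = \sum_i tens (x ⋅ p i) (q i).
Context {D : cstarAlgType R} (s : B -> D).

(** This is mu (s ⊗ s^⋆) m^*(x), see [frame_squareE]; multiplied by δ² it plays the role of pi x. *)
Definition frame_square (x : B) : D := \sum_i s (x ⋅ p i) ⋅ (s (q i)^⋆)^⋆.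

Hypothesis s_lin : linear s.

Lemma mul_sadj_bilin : bilin (fun x y : B => s x ⋅ (s y^⋆)^⋆).
Proof.
split=> [x k y y'|y k x x']; last by rewrite s_lin cmulDl cmulZl.
by rewrite cstarD cstarZ s_lin cstarD cstarZ conjCK cmulDr cmulZr.
Qed.

Lemma frame_square_linear : linear frame_square.
Proof.
move=> k x y; rewrite scaler_sumr -big_split; apply: eq_bigr => i _ /=.
by rewrite cmulDl cmulZl mul_sadj_bilin.2.
Qed.

Lemma frame_squareE x : mu_s_sadj s (mult_adj psi x) = frame_square x.
Proof. by rewrite mE /mu_s_sadj tlift_sum_tens //; exact: mul_sadj_bilin. Qed.

(** By linearity the relations need only be tested on elementary tensors; LQCK2 is read at x^⋆ ⊗ y,
    where s^⋆(x^⋆) becomes (s x)^⋆. *)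
Lemma local_QCK_familyP (e : D) :
  local_QCK_family psi A delta e s <->
  [/\ forall x y, frame_square x ⋅ s y = (delta%:C%C ^+ 2)^-1 *: s (x ⋅ y),
      forall x y, (s x)^⋆ ⋅ s y =
        (delta%:C%C ^+ 2)^-1 *: frame_square (A (x^⋆ ⋅ y)) &
      frame_square cone = (delta%:C%C ^+ 2)^-1 *: e].
Proof.
have m_lin : linear (mult_adj psi).
  move=> k x y; rewrite !mE scaler_sumr -big_split; apply: eq_bigr => i _ /=.
  by rewrite cmulDl cmulZl (tens_bilin _ _).2.
have sss_bilin : bilin (fun (T : tensor B B) (b : B) => mu_s_sadj s T ⋅ s b).
  split=> [T k b b'|b k T T']; first by rewrite s_lin cmulDr cmulZr.
  by rewrite /mu_s_sadj linearP cmulDl cmulZl.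
have mul_bilin := @cmul_bilin R B.
have ss_bilin : bilin (fun x y : B => sadj s x ⋅ s y).
  split=> [x k y y'|y k x x']; first by rewrite s_lin cmulDr cmulZr.
  by rewrite /sadj cstarD cstarZ s_lin cstarD cstarZ conjCK cmulDl cmulZl.
have [g gE] := linear_bundle s_lin.
have [h hE] := linear_bundle frame_square_linear.
have s_sum m (x : 'I_m -> B) : s (\sum_i x i) = \sum_i s (x i).
  by rewrite gE linear_sum.
have sq_sum m (x : 'I_m -> B) :
    frame_square (\sum_i x i) = \sum_i frame_square (x i).
  by rewrite hE linear_sum.
split=> [[_ K1 K2 K3]|[K1 K2 K3]].
  split=> [x y|x y|]; last by rewrite -frame_squareE.
    have := K1 (tens x y); rewrite /mult /mu_s_sadj_s /tmap.
    rewrite tlift_tens; last exact: tmap_bilin.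
    by rewrite !tlift_tens // frame_squareE.
  have := K2 (tens x^⋆ y); rewrite /mult /mu_sadj_s !tlift_tens //.
  by rewrite frame_squareE /sadj cstarK.
split=> // [T|T|]; last by rewrite frame_squareE.
  have [m [x [y ->]]] := tensor_sum_tens T.
  rewrite mult_sum_tens s_sum tmap_sum_tens // /mu_s_sadj_s tlift_sum_tens //.
  by rewrite scaler_sumr; apply: eq_bigr => i _; rewrite frame_squareE K1.
have [m [x [y ->]]] := tensor_sum_tens T.
rewrite mult_sum_tens frame_squareE [A _]linear_sum sq_sum scaler_sumr.
rewrite /mu_sadj_s tlift_sum_tens //; apply: eq_bigr => i _.
by rewrite /sadj K2 cstarK.
Qed.

End LocalFamily.

(** * Frame, compactness and faithfulness for the edge correspondence *)

Section QuantumEdges.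
Context {R : realType} {B : fdCstarAlgType R}.
Context {psi : {linear B -> R[i]^o}} {A : {linear B -> B}} {delta : R}.
Hypotheses (hG : quantum_graph psi A delta) (hA : completely_positive A).

Let hpsi : faithful_state psi.
Proof. by case: hG. Qed.

Let d2 : R[i] := delta%:C%C ^+ 2.
Let d2_neq0 : d2 != 0 := delta2_neq0 hG.

Context {n : nat} {p q : 'I_n -> B}.
Hypotheses (pq : dual_frame psi p q)
  (mE : forall x, mult_adj psi x = \sum_i tens (x ⋅ p i) (q i)).

(* [gen x y] is the vector x·ε·y of the edge correspondence. *)
Context {X : correspondence B} {gen : B -> B -> X}.
Hypotheses (hX : hilbert_module X) (gen_bilin : bilin gen)
  (gen_span : forall xi : X, exists n (x y : 'I_n -> B),
     xi = \sum_i gen (x i) (y i))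
  (lact_gen : forall x y z, lact X x (gen y z) = gen (x ⋅ y) z)
  (ract_gen : forall x y z, ract (gen x y) z = gen x (y ⋅ z))
  (ip_gen : forall x y x' y',
     corr_ip (gen x y) (gen x' y') = d2^-1 *: (y^⋆ ⋅ A (x^⋆ ⋅ x') ⋅ y'))
  (gen_resolution : forall x y,
     \sum_i gen (p i) (A (q i ⋅ x) ⋅ y) = d2 *: gen x y).

Lemma gen_ext (W : lmodType R[i]) (f g : X -> W) :
    linear f -> linear g ->
    (forall x y, f (gen x y) = g (gen x y)) ->
  f =1 g.
Proof.
move=> /linear_bundle[f' ->] /linear_bundle[g' ->] fg xi.
have [m [x [y ->]]] := gen_span xi.
by rewrite !linear_sum; apply: eq_bigr => i _; exact: fg.
Qed.

Let u i := gen (p i) cone.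
Let w i := gen (q i)^⋆ cone.

Lemma frame_expand_linear m (a b : 'I_m -> X) :
  linear (fun xi => \sum_i ract (a i) (corr_ip (b i) xi)).
Proof.
have [ract_bilin _ ip_lin _ _] := hX => k xi xi'.
rewrite scaler_sumr -big_split; apply: eq_bigr => i _ /=.
by rewrite ip_lin ract_bilin.1.
Qed.

Lemma gen_frame : module_frame u w.
Proof.
apply: gen_ext => [|//|x y]; first exact: frame_expand_linear.
under eq_bigr => i _ do
  rewrite ip_gen cstarK cstar1 cmul1x ract_gen cmul1x (bilinZr gen_bilin).
by rewrite -scaler_sumr gen_resolution scalerA mulVf ?scale1r.
Qed.

(** The star symmetry of m^*(1) exchanges p_i with q_i^⋆, so [gen_frame] turns into its flip. *)
Lemma gen_frame_flip : module_frame w u.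
Proof.
have [ract_bilin _ _ _ _] := hX.
apply: gen_ext => [|//|x y]; first exact: frame_expand_linear.
pose f a b := ract (gen a cone) (corr_ip (gen b^⋆ cone) (gen x y)).
have f_bilin : bilin f.
  split=> [a k b b'|b k a a']; rewrite /f; last by rewrite gen_bilin.2 ract_bilin.2.
  rewrite !ip_gen !cstarK cmulDl cmulZl linearP cmulDr cmulDl.
  rewrite cmulZr cmulZl scalerDr scalerA mulrC -scalerA.
  exact: ract_bilin.1.
rewrite -[RHS]gen_frame -[RHS](dual_frame_star hpsi pq f_bilin).
by apply: eq_bigr => i _; rewrite /f cstarK.
Qed.

(** The left action of x is applied termwise to the frame expansion; it commutes with the right
    action. *)
Lemma lact_theta x : lact X x = \sum_i theta (gen (x ⋅ p i) cone) (w i).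
Proof.
apply/lfunP => xi; rewrite theta_sumE // -[in LHS](gen_frame xi) linear_sum.
apply: eq_bigr => i _ /=.
have [m [a [b ->]]] := gen_span xi.
have [ract_bilin _ ip_lin _ _] := hX.
have [g gE] := linear_bundle (ip_lin (w i)).
rewrite gE !linear_sum -gE !(bilin_sumr ract_bilin) linear_sum /=.
by apply: eq_bigr => j _; rewrite ip_gen !ract_gen lact_gen.
Qed.

(** The ideal I consists of the x with A (a x b) = 0 for all a, b. It contains the kernel of the
    left action, and its unit, if nonzero, is a quantum source. *)
Lemma lact_faithful :
  ~ (exists z, quantum_source A z) -> forall y, lact X y = 0 -> y = 0.
Proof.
move=> no_source y y0.
(* Testing a and b on a basis presents I as the kernel of a single linear map. *)
pose f x : {ffun 'I_(\dim {:B}) * 'I_(\dim {:B}) -> B} :=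
  [ffun ij => A (bvec ij.1 ⋅ x ⋅ bvec ij.2)].
have f_lin : linear f.
  move=> k a b; apply/ffunP => ij; rewrite !ffunE.
  by rewrite cmulDr cmulDl cmulZr cmulZl linearP.
have [g gE] := linear_bundle f_lin.
pose I := lker (linfun g).
have IP x : x \in I <-> forall a b, A (a ⋅ x ⋅ b) = 0.
  rewrite memv_ker lfunE /= -gE; split=> [/eqP/ffunP fx0 a b|x0].
    rewrite (bvecE a) (bvecE b) cmul_sumr linear_sum big1 // => j _.
    rewrite !cmul_suml linear_sum big1 // => i _.
    by have := fx0 (i, j); rewrite !ffunE cmulZr !cmulZl !linearZ /= => ->;
      rewrite !scaler0.
  by apply/eqP/ffunP => ij; rewrite !ffunE x0.
have [z zI [zz z_star zC z_unit]] : exists2 z, z \in I &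
    [/\ z ⋅ z = z, z^⋆ = z, forall x, z ⋅ x = x ⋅ z &
        forall x, x \in I -> x ⋅ z = x].
  apply: (ideal_unit hpsi) => [x x' /IP x0|x x' /IP x0|x /IP x0]; apply/IP => a b.
  - by rewrite cmulA x0.
  - by rewrite cmulA -cmulA x0.
  - rewrite -[a ⋅ _ ⋅ _]cstarK (completely_positive_star hA) !cstarM cstarK cmulA.
    by rewrite x0 cstar0.
(* If y acts as zero, then 0 = <a^⋆·ε, y·(b·ε)> = δ^-2 A (a y b). *)
have yI : y \in I.
  apply/IP => a b; have := ip_gen a^⋆ cone (y ⋅ b) cone.
  rewrite -lact_gen y0 zero_lfunE cstarK cstar1 cmul1x cmulx1 cmulA.
  have [_ _ ip_lin _ _] := hX; have [h hE] := linear_bundle (ip_lin (gen a^⋆ cone)).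
  rewrite hE linear0 => /esym/eqP; rewrite scaler_eq0 invr_eq0 (negPf d2_neq0).
  by move/eqP.
have [->//|y_neq0] := eqVneq y 0; case: no_source; exists z; split=> // [|x].
  by apply: contraNneq y_neq0 => z0; rewrite -(z_unit y yI) z0 cmulx0.
by move/IP: zI => /(_ cone x); rewrite cmul1x.
Qed.

Lemma katsura_ideal_full :
  ~ (exists z, quantum_source A z) -> forall x, katsura_ideal X x.
Proof.
move=> no_source x; split=> [|y /(lact_faithful no_source)->]; last exact: cmulx0.
by rewrite lact_theta; exists n, (fun i => gen (x ⋅ p i) cone), w.
Qed.

Let edge_family (D : cstarAlgType R) (t : X -> D) x :=
  (delta%:C%C)^-1 *: t (gen x cone).

Lemma edge_family_linear (D : cstarAlgType R) (t : X -> D) :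
  linear t -> linear (edge_family t).
Proof.
move=> t_lin k x y; rewrite /edge_family gen_bilin.2 t_lin scalerDr.
by rewrite !scalerA mulrC.
Qed.

(** * From a covariant representation to a local family *)

Section Covariant.
Context {D : cstarAlgType R} { pi : B -> D} {t : X -> D}.
Hypotheses (no_source : ~ exists z, quantum_source A z)
  (cov : covariant pi t).

Let rep : representation pi t := cov.1.

(** Every x lies in the Katsura ideal, so pi x is ψ_t of the sum in [lact_theta]; the two factors
    δ^-1 of the family give δ^-2. *)
Lemma covariant_square x :
  frame_square (p := p) (q := q) (edge_family t) x = d2^-1 *: pi x.
Proof.
have [_ [f [f_lin _ _ f_theta] /(_ x (katsura_ideal_full no_source x))->]] := cov.
have f_sum m (a b : 'I_m -> X) :
    f (\sum_i theta (a i) (b i)) = \sum_i t (a i) ⋅ (t (b i))^⋆.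
  (* [f] is known to be additive on compact operators only, so every partial sum of the induction
     has to be compact. *)
  have comp k (a' b' : 'I_k -> X) : compact_op (\sum_i theta (a' i) (b' i)).
    by exists k, a', b'.
  have f0 : f 0 = 0.
    have c0 : compact_op (0 : 'End(X)).
      by have := comp 0%N (fun=> 0) (fun=> 0); rewrite big_ord0.
    by have := f_lin (-1) 0 0 c0 c0; rewrite scaler0 addr0 scaleN1r addNr.
  elim: m a b => [|m IHm] a b; first by rewrite !big_ord0.
  rewrite !big_ord_recl -[theta _ _]scale1r f_lin ?scale1r; last exact: comp.
    by rewrite f_theta IHm.
  by have := comp 1%N (fun=> a ord0) (fun=> b ord0); rewrite big_ord1.
rewrite lact_theta f_sum scaler_sumr; apply: eq_bigr => i _.
rewrite /edge_family cstarZ cmulZl cmulZr scalerA; congr (_ *: _).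
rewrite conj_Creal ?realV; last by apply/complex_realP; exists delta.
by rewrite /d2 expr2 invfM.
Qed.

(** With [covariant_square], LQCK1 becomes compatibility with the left action, LQCK2 the inner
    product axiom combined with [ip_gen], and LQCK3 the case x = 1. *)
Lemma edge_family_LQCK : local_QCK_family psi A delta (pi cone) (edge_family t).
Proof.
have [[_ _ _] t_lin lact_t ip_t] := rep.
apply/(local_QCK_familyP mE (edge_family_linear t_lin)); split=> [x y|x y|].
- rewrite covariant_square cmulZl cmulZr lact_t lact_gen; congr (_ *: _).
- rewrite covariant_square /edge_family cstarZ cmulZl cmulZr scalerA ip_t.
  rewrite ip_gen cstar1 cmul1x cmulx1 conj_Creal ?realV; last first.
    by apply/complex_realP; exists delta.
  have [[pi_lin _ _] _ _ _] := rep; have [g gE] := linear_bundle pi_lin.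
  by rewrite gE linearZ /d2 expr2 invfM.
- exact: covariant_square.
Qed.

(** pi x is recovered from the family by [covariant_square], and then t (x·ε·y) = δ S(x) pi(y). *)
Lemma edge_family_generates :
  cstar_generates (range pi `|` range t)%classic ->
  cstar_generates (range (edge_family t)).
Proof.
move=> gen_full P P_sub SP; apply: gen_full => //.
have [_ P0 P_lin P_mul P_star] := P_sub.
have PZ a x : P x -> P (a *: x).
  by move=> Px; rewrite -[_ *: x]addr0; exact: P_lin.
have P_sum m (x : 'I_m -> D) : (forall i, P (x i)) -> P (\sum_i x i).
  move=> Px; apply: (big_ind P) => // a b Pa Pb.
  by rewrite -[a]scale1r; exact: P_lin.
have PS x : P (edge_family t x) by apply: SP; exists x.
have P_pi x : P (pi x).
  rewrite -[pi x]scale1r -(mulfV d2_neq0) -scalerA -covariant_square.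
  by apply/PZ/P_sum => i; apply: P_mul => //; exact: P_star.
have [_ t_lin _ _] := rep; have [g gE] := linear_bundle t_lin.
move=> _ [[x _ <-]|[xi _ <-]] //.
have [m [x [y ->]]] := gen_span xi.
rewrite gE linear_sum -gE; apply: P_sum => i.
rewrite -[y i]cmul1x -ract_gen -(representation_ract hX rep); apply: P_mul => //.
have := PZ delta%:C%C _ (PS (x i)).
by rewrite /edge_family scalerA mulfV ?scale1r // (delta_neq0 hG).
Qed.

(** pi 1 fixes both kinds of generators on either side, and the elements so fixed form a
    C*-subalgebra. *)
Lemma covariant_unit :
  cstar_generates (range pi `|` range t)%classic -> cstar_unit (pi cone).
Proof.
move=> gen_full; have [[_ piM pi_star] t_lin lact_t _] := rep.
have /gen_full full :
    cstar_subalg [set x : D | pi cone ⋅ x = x /\ x ⋅ pi cone = x]%classic.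
  by apply: unit_for_subalg; rewrite -pi_star cstar1.
have unitT x : pi cone ⋅ x = x /\ x ⋅ pi cone = x.
  suff: [set x | pi cone ⋅ x = x /\ x ⋅ pi cone = x]%classic x by [].
  rewrite full //= => _ [[y _ <-]|[xi _ <-]] /=; first by rewrite -!piM cmul1x cmulx1.
  rewrite (representation_ract hX rep) lact_t.
  have [m [a [b ->]]] := gen_span xi; have [ract_bilin _ _ _ _] := hX.
  rewrite linear_sum (bilin_suml ract_bilin).
  by split; congr (t _); apply: eq_bigr => i _;
    rewrite /= ?lact_gen ?ract_gen ?cmul1x ?cmulx1.
by split=> x; case: (unitT x).
Qed.

End Covariant.

(** * From a local family to a covariant representation *)

Section Universal.
Context {D : cstarAlgType R} {e : D} {s : B -> D}.
Hypotheses (e_unit : cstar_unit e) (s_lin : linear s)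
  (s_QCK : local_QCK_family psi A delta e s).

Let sq := frame_square (p := p) (q := q) s.
Let pi x := d2 *: sq x.

Let s_mul x y : pi x ⋅ s y = s (x ⋅ y).
Proof.
have [K1 _ _] := (local_QCK_familyP mE s_lin e).1 s_QCK.
by rewrite cmulZl K1 scalerA mulfV ?scale1r.
Qed.

(** One factor is that of LQCK2, the other compensates the δ² in [pi]. *)
Let s_star x y : (s x)^⋆ ⋅ s y = d2^-1 *: (d2^-1 *: pi (A (x^⋆ ⋅ y))).
Proof.
have [_ K2 _] := (local_QCK_familyP mE s_lin e).1 s_QCK.
by rewrite K2 /pi [d2^-1 *: (d2 *: _)]scalerA mulVf ?scale1r.
Qed.

Let pi1 : pi cone = e.
Proof.
have [_ _ K3] := (local_QCK_familyP mE s_lin e).1 s_QCK.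
by rewrite /pi /sq K3 scalerA mulfV ?scale1r.
Qed.

Let d2_conj : d2^* = d2.
Proof. by apply: (can_inj invrK); rewrite -fmorphV; exact: delta2V_conj. Qed.

(** Multiplicativity is LQCK1 applied termwise. For adjoints, the star symmetry of m^*(1) restores
    the order of the legs and [dual_frame_mul] moves x^⋆ back to the first one. *)
Lemma family_starhom : starhom pi.
Proof.
have pi_lin : linear pi.
  move=> k x y; rewrite /pi /sq frame_square_linear // scalerDr !scalerA.
  by rewrite mulrC.
split=> // [x y|x].
  rewrite {1 3}/pi cmulZr; congr (_ *: _).
  by rewrite cmul_sumr; apply: eq_bigr => i _; rewrite cmulA s_mul cmulA.
rewrite /pi cstarZ d2_conj; congr (_ *: _); rewrite cstar_sum.
have [g gE] := linear_bundle s_lin.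
have f_bilin : bilin (fun a b => s a ⋅ (s (x ⋅ b^⋆))^⋆).
  split=> [a k b b'|b k a a']; last by rewrite s_lin cmulDl cmulZl.
  rewrite cstarD cstarZ cmulDr cmulZr s_lin cstarD cstarZ conjCK.
  by rewrite cmulDr cmulZr.
transitivity (\sum_i s (q i)^⋆ ⋅ (s (x ⋅ (p i)^⋆^⋆))^⋆); last first.
  by apply: eq_bigr => i _; rewrite cstarM !cstarK.
rewrite (dual_frame_star hpsi pq f_bilin).
rewrite /sq /frame_square (dual_frame_mul hpsi pq _ (mul_sadj_bilin s_lin)).
by apply: eq_bigr => i _; rewrite cstarM cstarK.
Qed.

Let F x y := delta%:C%C *: (s x ⋅ pi y).

Let F_bilin : bilin F.
Proof.
have [pi_lin _ _] := family_starhom.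
split=> [x k y y'|y k x x']; rewrite /F.
  by rewrite pi_lin cmulDr cmulZr scalerDr !scalerA mulrC.
by rewrite s_lin cmulDl cmulZl scalerDr !scalerA mulrC.
Qed.

Let F_star x y x' y' :
  (F x y)^⋆ ⋅ F x' y' = pi (corr_ip (gen x y) (gen x' y')).
Proof.
have [pi_lin piM pi_star] := family_starhom.
have [g gE] := linear_bundle pi_lin.
rewrite ip_gen gE linearZ -gE !piM pi_star /F /=; have := s_star x x'.
move: (pi (A _)) (pi y) (pi y') => a b c ss.
rewrite cstarZ cstarM cmulZl cmulZr scalerA.
rewrite conj_Creal; last by apply/complex_realP; exists delta.
rewrite -cmulA (cmulA (s x)^⋆) ss !cmulZl !cmulZr !scalerA -expr2 -/d2.
by rewrite mulfV // mul1r cmulA.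
Qed.

(** [F_star] extends to sums and yields both the inner product axiom and the existence of t on the
    span. *)
Lemma family_covariant : exists2 t : X -> D, covariant pi t &
  forall x, s x = edge_family t x.
Proof.
have [pi_lin piM pi_star] := family_starhom.
have [ract_bilin _ ip_lin _ _] := hX.
have [g gE] := linear_bundle pi_lin.
have F_sum m k (x y : 'I_m -> B) (x' y' : 'I_k -> B) :
    (\sum_i F (x i) (y i))^⋆ ⋅ (\sum_j F (x' j) (y' j)) =
    pi (corr_ip (\sum_i gen (x i) (y i)) (\sum_j gen (x' j) (y' j))).
  rewrite corr_ip_suml // gE linear_sum cstar_sum cmul_suml.
  apply: eq_bigr => i _; have [h hE] := linear_bundle (ip_lin (gen (x i) (y i))).
  rewrite hE linear_sum linear_sum -hE -gE cmul_sumr.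
  by apply: eq_bigr => j _; exact: F_star.
have [m x y gen0|t tE] := linear_extension gen_bilin F_bilin gen_span.
  (* For a vanishing sum of generators, d^⋆ d = pi 0 = 0 for its would-be image d. *)
  apply: cstar_mul_eq0; rewrite F_sum gen0.
  have [h hE] := linear_bundle (ip_lin 0).
  by rewrite hE linear0 gE linear0.
have t_sum m (x y : 'I_m -> B) :
    t (\sum_i gen (x i) (y i)) = \sum_i F (x i) (y i).
  by rewrite linear_sum; apply: eq_bigr => i _; rewrite tE.
have t1 x : t (gen x cone) = delta%:C%C *: s x.
  by rewrite tE /F pi1; have [_ ->] := e_unit.
have rep : representation pi t.
  split=> // [|x xi|xi eta].
  - exact: linearP.
  - have [m [a [b ->]]] := gen_span xi.
    rewrite t_sum linear_sum cmul_sumr /=.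
    under [in RHS]eq_bigr => i _ do rewrite lact_gen.
    rewrite t_sum; apply: eq_bigr => i _.
    by rewrite /F cmulZr cmulA s_mul.
  - have [m [a [b ->]]] := gen_span xi; have [k [c [d ->]]] := gen_span eta.
    by rewrite !t_sum F_sum.
exists t => [|x]; last first.
  by rewrite /edge_family t1 scalerA mulVf ?scale1r // (delta_neq0 hG).
split=> //; exists (frame_rep (t := t) (u := u) (w := w)).
  exact: (frame_compact_rep hX rep gen_frame gen_frame_flip).
(* At the left action of x, [frame_rep] is the sum of t (x p_i·ε) (t (q_i^⋆·ε))^⋆, which is the sum
   defining [pi x]. *)
move=> x _; rewrite /pi scaler_sumr; apply: eq_bigr => i _.
rewrite lact_gen !t1 cstarZ cmulZl cmulZr scalerA; congr (_ *: _).
by rewrite conj_Creal //; apply/complex_realP; exists delta.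
Qed.

End Universal.
End QuantumEdges.

(** * Specialization to the edge correspondence and conclusion *)

Lemma edge_corr_generators (R : realType) (B : fdCstarAlgType R)
    (psi : {linear B -> R[i]^o}) (A : {linear B -> B}) (delta : R)
    (hG : quantum_graph psi A delta) (hA : completely_positive A)
    n (p q : 'I_n -> B) (pq : dual_frame psi p q)
    (mE : forall x, mult_adj psi x = \sum_i tens (x ⋅ p i) (q i)) :
  let X := edge_corr psi A delta in
  hilbert_module X /\
  exists gen : B -> B -> X,
  [/\ bilin gen,
      forall xi : X, exists n (x y : 'I_n -> B), xi = \sum_i gen (x i) (y i),
      forall x, gen x cone = lact X x (edge_vector psi A delta) &
  [/\ forall x y z, lact X x (gen y z) = gen (x ⋅ y) z,
      forall x y z, ract (gen x y) z = gen x (y ⋅ z),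
      forall x y x' y', corr_ip (gen x y) (gen x' y') =
        (delta%:C%C ^+ 2)^-1 *: (y^⋆ ⋅ A (x^⋆ ⋅ x') ⋅ y') &
      forall x y, \sum_i gen (p i) (A (q i ⋅ x) ⋅ y) =
        delta%:C%C ^+ 2 *: gen x y]].
Proof.
move=> X; have [hpsi _ _ _] := hG.
have EP := edge_spaceP psi A delta.
have lb := @blact_bilin R B; have rb := @bract_bilin R B.
have lA := @blactA R B; have rA := @bractA R B; have lr := @blact_bract R B.
split.
  exact: (cyclic_hilbert_module rb rA (@bip_linear _ _ psi) (bip_star hpsi)
    (@bip_bract _ _ psi) EP).
pose gen : B -> B -> X := cyclic_gen (l := @blact R B) (r := @bract R B)
  (ip := bip psi) (eps := edge_indicator psi A delta) (E := edge_space psi A delta).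
have genl x y z : lact X x (gen y z) = gen (x ⋅ y) z.
  exact: (cyclic_lact_gen (ip := bip psi) lb lA lr EP).
exists gen; split; first exact: (cyclic_gen_bilin (ip := bip psi) lb rb EP).
- exact: (cyclic_gen_span (ip := bip psi) EP).
- move=> x; have -> : edge_vector psi A delta = gen cone cone.
    by congr (vsproj _ _); rewrite blact1 bract1.
  by rewrite genl cmulx1.
split=> //.
- exact: (cyclic_ract_gen (ip := bip psi) rb rA EP).
- move=> x y x' y'; rewrite -(edge_ip hG hA pq mE).
  exact: (cyclic_ip_gen (ip := bip psi) EP).
- move=> x y; apply: subvs_inj.
  have gen_val a b : vsval (gen a b) = bract (blact a (edge_indicator psi A delta)) b.
    exact: (val_cyclic_gen (ip := bip psi) EP).
  rewrite linearZ linear_sum /=.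
  etransitivity; last by rewrite gen_val.
  rewrite -(edge_resolution hG pq mE).
  by apply: eq_bigr => i _; rewrite gen_val.
Qed.

Theorem theorem3p6 (R : realType) (B : fdCstarAlgType R)
    (psi : {linear B -> R[i]^o}) (A : {linear B -> B}) (delta : R)
    (hG : quantum_graph psi A delta) (hA : completely_positive A)
    (OE : cstarAlgType R) (piE : B -> OE) (tE : edge_corr psi A delta -> OE)
    (hOE : cuntz_pimsner piE tE)
    (hsource : ~ exists z : B, quantum_source A z) :
  let S := edge_map tE in
  (exists e : OE, cstar_unit e /\ local_QCK_family psi A delta e S) /\
  cstar_generates (range S) /\
  (forall (D : cstarAlgType R) (e : D) (s : B -> D),
     cstar_unit e -> local_QCK_family psi A delta e s ->
     exists rho : OE -> D, starhom rho /\ (forall x, s x = rho (S x))).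
Proof.
move=> S; have [hpsi _ _ _] := hG; have [cov gen_full univ] := hOE.
have [n [p [q [pq mE]]]] := dual_frame_exists hpsi.
have [hX [gen [gen_bilin gen_span gen1 [genl genr gen_ip gen_res]]]] :=
  edge_corr_generators hG hA pq mE.
have SE : S = fun x => (delta%:C%C)^-1 *: tE (gen x cone).
  by apply/funext => x; rewrite /S /edge_map gen1.
rewrite SE; split; [|split].
(* The unit of the Cuntz-Pimsner algebra is the image of 1 under the universal representation. *)
- exists (piE cone); split.
    exact: (covariant_unit hX gen_span genl genr cov gen_full).
  exact: (edge_family_LQCK hG hA mE hX gen_bilin gen_span genl genr gen_ip
    gen_res hsource cov).
- exact: (edge_family_generates hG hA hX gen_bilin gen_span genl genr gen_ip
    gen_res hsource cov gen_full).
move=> D e s e_unit s_QCK; have [s_lin _ _ _] := s_QCK.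
have [t t_cov st] := family_covariant hG pq mE hX gen_bilin gen_span genl genr
  gen_ip gen_res e_unit s_lin s_QCK.
have [rho [rho_lin rhoM rho_star] [_ t_rho]] := univ _ _ _ t_cov.
exists rho; split=> // x; have [g gE] := linear_bundle rho_lin.
by rewrite st t_rho gE linearZ.
Qed.
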